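(* Let $\bar f(x,w):[-1,1]^n\times[-1,1]^m\to\mathbb{R}$, $n,m\ge 1$, be a smooth function of $[x,w]\in[-1,1]^{n+m}$ which is analytic (i.e. extends analytically) on the set of all $[x,w]\in\mathbb{C}^{n+m}$ with $\Re(x_1^2+\cdots+x_n^2+w_1^2+\cdots+w_m^2)\ge -t^2$, for some $t>0$. Then for any $\varepsilon>0$ there exist $h\in\mathbb{Z}^+$ and two Chebyshev polynomials $\bar\phi(x):[-1,1]^n\to\mathbb{R}^{1\times h}$ and $\bar a(w):[-1,1]^m\to\mathbb{R}^{h\times 1}$ such that $$\sup_{[x,w]\in[-1,1]^{n+m}}\|\bar f(x,w) - \bar\phi(x)\bar a(w)\| \le \varepsilon$$ and $h = O\big((\log(1/\varepsilon))^m\big)$.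
   Context: $\Re(\cdot)$ denotes the real part of a complex number. A Chebyshev polynomial here means a (vector of) polynomial(s) expressed as finite sums of products of Chebyshev polynomials $T_k$ in the coordinates. *)

(* Defs.v *)
From mathcomp Require Import all_boot all_order all_algebra.
From mathcomp Require Import all_classical all_reals all_analysis.
From mathcomp Require Import complex.
Set Implicit Arguments. Unset Strict Implicit. Unset Printing Implicit Defensive.
Import Order.TTheory GRing.Theory Num.Theory numFieldNormedType.Exports.
Local Open Scope ring_scope.
Local Open Scope classical_set_scope.

(* The complex numbers over a real type R, seen as a numFieldType
   (hence a normed module over itself, with the usual modulus topology). *)
Definition Cx (R : realType) : numFieldType := R[i].

Fixpoint cheb (R : pzRingType) (k : nat) (x : R) : R :=
  match k with
  | 0 => 1
  | S k' => match k' with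
            | 0 => x
            | S k'' => 2 * x * cheb k' x - cheb k'' x
            end
  end.

Definition cheb_poly (R : realType) (n : nat) (p : 'rV[R]_n -> R) : Prop :=
  exists s : seq (R * {ffun 'I_n -> nat}),
    forall x : 'rV[R]_n,
      p x = \sum_(j <- s) j.1 * \prod_(i < n) cheb (j.2 i) (x 0 i).

Definition cheb_row (R : realType) (n h : nat) (phi : 'rV[R]_n -> 'rV[R]_h) :=
  forall j : 'I_h, cheb_poly (fun x => phi x 0 j).
Definition cheb_col (R : realType) (m h : nat) (a : 'rV[R]_m -> 'cV[R]_h) :=
  forall j : 'I_h, cheb_poly (fun w => a w j 0).

Definition in_cube (R : realType) (n : nat) (x : 'rV[R]_n) : Prop :=
  forall i : 'I_n, -1 <= x 0 i <= 1.

Definition reg_set (R : realType) (N : nat) (t : R) : set 'rV[Cx R]_N :=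
  [set z | - t ^+ 2 <= complex.Re (\sum_(i < N) z 0 i ^+ 2)].

(* f (as a function of [x,w] in [-1,1]^(n+m)) extends analytically
   (= holomorphically: complex Frechet differentiable) to an open
   neighbourhood of the set S in C^(n+m). *)
Definition analytic_ext_on (R : realType) (n m : nat)
    (f : 'rV[R]_n -> 'rV[R]_m -> R) (S : set 'rV[Cx R]_(n + m)) : Prop :=
  exists (U : set 'rV[Cx R]_(n + m)) (F : 'rV[Cx R]_(n + m) -> (Cx R)^o),
    [/\ open U, S `<=` U,
        (forall z, U z -> differentiable F z) &
        (forall x w, in_cube x -> in_cube w ->
           F (map_mx (fun r : R => (r%:C)%C : Cx R) (row_mx x w)) = ((f x w)%:C)%C)].

(* Main.v *)
Require Import Defs.
From mathcomp Require Import all_boot all_order all_algebra.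
From mathcomp Require Import all_classical all_reals all_analysis.
From mathcomp Require Import complex.
From mathcomp Require Import ring lra.
Set Implicit Arguments. Unset Strict Implicit. Unset Printing Implicit Defensive.
Import Order.TTheory GRing.Theory Num.Theory numFieldNormedType.Exports.
Local Open Scope ring_scope.
Local Open Scope classical_set_scope.

(* If all coordinates but one are real points of the cube, the Joukowski map
   [u |-> (u + 1/u)/2] sends an annulus around the unit circle into the region
   where f is holomorphic, so [B u = f((u + 1/u)/2)] is holomorphic there.
   Goursat's theorem in the variable [log u] makes the circle means of
   [u^k (B u - B u0)/(u - u0)] independent of the radius.  Moving the circle
   inwards or outwards shows that the Fourier partial sum of order K of B
   approximates B on the unit circle up to O(e^(-sK)).

   The discrete Fourier projection on 2K+1 equispaced nodes reproduces
   trigonometric polynomials of degree K and has norm at most 2K+1, hence it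
   inherits this error.  It samples f at real points only, so that it can be
   composed over all coordinates: the total error is polynomial in K times
   e^(-sK).  The result is a Chebyshev sum of degree at most K in each w_i,
   that is, (K+1)^m separated terms, and K of order log(1/eps) suffices. *)

(** * The modulus on R[i] and holomorphy *)

(** The difference quotient of B at a point of the unit circle is holomorphic away from that point,
    but at the point itself only continuity comes for free. Circles are therefore deformed on each
    side of the unit circle separately and the result is carried to the unit circle by continuity,
    so that no removable singularity theorem is required. Both sides matter: the Dirichlet kernel
    times [u - u0] has just two terms, of which one is small on smaller circles and the other on
    larger ones.

    Several complex variables enter only through a product of boxes of margin [t / (n + m)] around
    [-1,1]. It lies in the region of analyticity, and being compact it gives one bound on the
    extension that serves all slices at once.

    The x coordinates are interpolated too, but only to make [phi] a polynomial. Terms are counted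
    in w alone, which is why the exponent in the bound on h is m and not n + m. *)

Section Modulus.
Variable R : realType.
Implicit Types (z w : R[i]) (x y : R).
Local Notation normc := (@ComplexField.Normc.normc R).

Lemma norm_complexE z : `|z| = (normc z)%:C%C.
Proof. by []. Qed.

Lemma normc_ge0 z : 0 <= normc z.
Proof. by case: z => a b; exact: sqrtr_ge0. Qed.

Lemma normcD z w : normc (z + w) <= normc z + normc w.
Proof. exact: (le_normcD z w). Qed.

Lemma normcN z : normc (- z) = normc z.
Proof. by case: z => a b /=; rewrite !sqrrN. Qed.

Lemma normcB z w : normc (z - w) <= normc z + normc w.
Proof. by rewrite -(normcN w) normcD. Qed.

Lemma normc_dist z w : normc (z - w) = normc (w - z).
Proof. by rewrite -normcN opprB. Qed.

Lemma normcX z k : normc (z ^+ k) = normc z ^+ k.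
Proof.
elim: k => [|k IH]; first by rewrite !expr0 ComplexField.Normc.normc1.
by rewrite !exprS ComplexField.Normc.normcM IH.
Qed.

Lemma normc_real x : normc (x%:C)%C = `|x|.
Proof. by rewrite /= expr0n /= addr0 sqrtr_sqr. Qed.

Lemma Re_le_normc z : `|complex.Re z| <= normc z.
Proof.
case: z => a b /=; rewrite -sqrtr_sqr ler_wsqrtr // lerDl sqr_ge0 //.
Qed.

Lemma Im_le_normc z : `|complex.Im z| <= normc z.
Proof.
case: z => a b /=; rewrite -sqrtr_sqr ler_wsqrtr // lerDr sqr_ge0 //.
Qed.

Lemma normc_le_ReIm z : normc z <= `|complex.Re z| + `|complex.Im z|.
Proof.
case: z => a b /=.
rewrite -[leRHS]ger0_norm ?addr_ge0 // -sqrtr_sqr ler_wsqrtr //.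
rewrite -[a ^+ 2]real_normK ?num_real // -[b ^+ 2]real_normK ?num_real //.
have := normr_ge0 a; have := normr_ge0 b; nra.
Qed.

Lemma normc_sum (I : Type) (r : seq I) (P : pred I) (F : I -> R[i]) :
  normc (\sum_(i <- r | P i) F i) <= \sum_(i <- r | P i) normc (F i).
Proof.
elim/big_ind2 : _ => // [|a b c d ab cd]; first by rewrite ComplexField.Normc.normc0.
by apply: le_trans (normcD _ _) (lerD _ _).
Qed.

(** The form without division, with real e and dl: v = u needs no separate case, and the estimates
    are between real numbers. *)
Definition cdiff (Q : R[i] -> R[i]) u := exists d, forall e, 0 < e ->
  exists2 dl, 0 < dl & forall v, normc (v - u) < dl ->
    normc (Q v - Q u - d * (v - u)) <= e * normc (v - u).

Definition ccont (Q : R[i] -> R[i]) u := forall e, 0 < e ->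
  exists2 dl, 0 < dl & forall v, normc (v - u) < dl -> normc (Q v - Q u) < e.

Lemma differentiable_cdiff (Q : (Cx R)^o -> (Cx R)^o) u :
  differentiable Q u -> cdiff Q u.
Proof.
move=> /(@diff_derivable _ _ _ _ _ (1 : Cx R)) /cvg_ex [d /= Qd].
exists d => e e0.
have e0' : 0 < (e%:C)%C :> Cx R by rewrite ltcR.
move: Qd => /cvgrPdist_le /(_ _ e0') [dl /= dl0 H].
(* In the order on complex numbers a positive element has imaginary part zero, so the radius [dl] is
   real. *)
have dlE : dl = ((complex.Re dl)%:C)%C.
  by move: dl0; rewrite ltcE /= => /andP[/eqP]; case: (dl) => a b /= ->.
exists (complex.Re dl); first by move: dl0; rewrite dlE ltcR.
move=> v vu; have [->|vu0] := eqVneq v u.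
  by rewrite !subrr mulr0 subrr ComplexField.Normc.normc0 mulr0.
have vu1 : v - u != 0 by rewrite subr_eq0.
have := H (v - u); rewrite /ball_ /= sub0r normrN dlE.
rewrite {1}norm_complexE ltcR => /(_ vu vu1).
rewrite scaler1 subrK norm_complexE lecR => H1.
have -> : Q v - Q u - d * (v - u) = - ((d - (v - u)^-1 *: (Q v - Q u)) * (v - u)).
  rewrite mulrBl /GRing.scale /= mulrAC mulVf // mul1r; ring.
by rewrite normcN ComplexField.Normc.normcM ler_wpM2r // normc_ge0.
Qed.

Lemma continuous_ccont (Q : (Cx R)^o -> (Cx R)^o) u :
  {for u, continuous Q} -> ccont Q u.
Proof.
move=> Qc e e0.
have e0' : 0 < (e%:C)%C :> Cx R by rewrite ltcR.
move: Qc => /cvgrPdist_lt /(_ _ e0') [dl /= dl0 H].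
have dlE : dl = ((complex.Re dl)%:C)%C.
  by move: dl0; rewrite ltcE /= => /andP[/eqP]; case: (dl) => a b /= ->.
exists (complex.Re dl); first by move: dl0; rewrite dlE ltcR.
move=> v vu.
have vu' : normc ((u : R[i]) - v) < complex.Re dl.
  by apply: le_lt_trans vu; rewrite -normcN opprB.
have := H v; rewrite /ball_ /= dlE {1}norm_complexE ltcR => /(_ vu').
by rewrite norm_complexE ltcR; apply: le_lt_trans; rewrite -normcN opprB.
Qed.

Lemma cdiff_differentiable (Q : (Cx R)^o -> (Cx R)^o) (u : (Cx R)^o) :
  cdiff Q u -> differentiable Q u.
Proof.
move=> [d Qd]; apply/derivable1_diffP/cvg_ex; exists d => /=.
apply/cvgrPdist_le => e e0.
have eE : e = ((complex.Re e)%:C)%C.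
  by move: e0; rewrite ltcE /= => /andP[/eqP]; case: (e) => a b /= ->.
have e1 : 0 < complex.Re e by move: e0; rewrite eE ltcR.
have [dl dl0 H] := Qd _ e1.
exists (dl%:C)%C; first by rewrite /= ltcR.
move=> h; rewrite /ball_ /= sub0r normrN norm_complexE ltcR => hd h0.
have := H (h + u); rewrite addrK => /(_ hd) H1.
rewrite eE norm_complexE lecR scaler1.
have n0 : 0 < normc h.
  rewrite lt_neqAle normc_ge0 andbT eq_sym; apply: contra_neq h0.
  exact: ComplexField.Normc.eq0_normc.
rewrite -(ler_pM2r n0) -ComplexField.Normc.normcM.
rewrite -normcN; have -> // : - ((d - h^-1 *: (Q (h + u) - Q u)) * h) = Q (h + u) - Q u - d * h.
rewrite mulrBl /GRing.scale /= mulrAC mulVf // mul1r; ring.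
Qed.

End Modulus.

(** * Integrals of complex-valued functions on the line *)

Section Integral.
Variable R : realType.
Implicit Types (f F : R -> R) (a b c x y : R).
Local Notation normc := (@ComplexField.Normc.normc R).
Local Notation mu := (@lebesgue_measure R).

Lemma derive_bound f F a b M : a <= b ->
  (forall x, a <= x <= b -> is_derive x 1 F (f x)) ->
  (forall x, a <= x <= b -> `|f x| <= M) -> `|F b - F a| <= M * (b - a).
Proof.
move=> ab dF fM.
have [||x xab ->] := @MVT_segment R F f a b ab.
- move=> x; rewrite in_itv /= => /andP[ax xb]; apply: dF.
  by rewrite (ltW ax) (ltW xb).
- apply: derivable_within_continuous => x; rewrite in_itv /= => xab.
  by have [] := dF _ xab.
- rewrite normrM ler_pM // ?(ger0_norm (x := b - a)) ?subr_ge0 //.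
  by apply: fM; rewrite in_itv /= in xab.
Qed.

Lemma antiderivative_on f A : continuous f ->
  exists F, forall x, - A < x < A -> is_derive x 1 F (f x).
Proof.
move=> fc; exists (fun x => \int[mu]_(t in `[- A, x]) f t)%R => x /andP[Ax xA].
have fi : mu.-integrable `[- A, A] (EFin \o f).
  apply: continuous_compact_integrable; first exact: segment_compact.
  exact: continuous_subspaceT.
have [dF <-] := continuous_FTC1_closed xA fi Ax (fc x).
by rewrite derive1E; apply: derivableP.
Qed.


(** Antiderivatives on the intervals (-n, n), normalised to vanish at 0, agree wherever two of them
    are defined, so they glue to one on the whole line. *)
Lemma antiderivative_ex f : continuous f ->
  exists F, forall x, is_derive x 1 F (f x).
Proof.
move=> fc.
have [H HP] := choice (fun n : nat => antiderivative_on n%:R fc).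
have uniq m n x : `|x| < m%:R -> `|x| < n%:R -> H m x - H m 0 = H n x - H n 0.
  rewrite !ltr_norml => xm xn.
  have dH y : - m%:R < y < m%:R -> - n%:R < y < n%:R ->
      is_derive y 1 (H m - H n) 0.
    move=> ym yn; have dm := HP m _ ym; have dn := HP n _ yn.
    by apply: is_derive_eq; rewrite subrr.
  suff : `|(H m - H n) x - (H m - H n) 0| <= 0.
    rewrite normr_le0 subr_eq0 => /eqP; rewrite !fctE => E.
    by lra.
  have [x0|x0] := leP 0 x.
    apply: le_trans (@derive_bound (fun=> 0) _ 0 x 0 x0 _ _) _; last by rewrite mul0r.
      by move=> y ?; apply: dH; lra.
    by move=> y _; rewrite normr0.
  rewrite distrC; apply: le_trans (@derive_bound (fun=> 0) _ x 0 0 (ltW x0) _ _) _; last by rewrite mul0r.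
    by move=> y ?; apply: dH; lra.
  by move=> y _; rewrite normr0.
(* The extra unit leaves room around x: every y at distance less than 1 still lies in (- N x, N x),
   so the glued function coincides near x with a single [H (N x)]. *)
pose N x := (Num.truncn `|x|).+2.
have NP x : `|x| + 1 < (N x)%:R.
  by rewrite /N -natr1 ltrD2r; apply: truncnS_gt.
exists (fun x => H (N x) x - H (N x) 0) => x.
have xN : - (N x)%:R < x < (N x)%:R by rewrite -ltr_norml; have := NP x; lra.
have dx := HP _ _ xN.
have dx' : is_derive x 1 (H (N x) - cst (H (N x) 0)) (f x).
  by apply: is_derive_eq; rewrite subr0.
apply: near_eq_is_derive dx'.
near=> y; rewrite /= !fctE; apply: esym; apply: uniq.
  by have := NP y; lra.
have : `|x - y| < 1 by near: y; apply: cvgr_dist_lt; [exact: cvg_id|].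
have := NP x; have := ler_distD x y 0; rewrite !subr0 distrC; lra.
Unshelve. all: by end_near. Qed.

(** Zero if f has no antiderivative. An integral defined as a difference of its values is oriented,
    and additive in the interval for every integrand. *)
Definition antiderivative f : R -> R :=
  xget (fun=> 0) [set F | forall x, is_derive x 1 F (f x)].

Definition rint f a b := antiderivative f b - antiderivative f a.

Lemma rintE f F a b : (forall x, is_derive x 1 F (f x)) -> rint f a b = F b - F a.
Proof.
move=> dF; rewrite /rint.
have dA x : is_derive x 1 (antiderivative f) (f x).
  exact: (xgetPex (fun=> 0) (ex_intro (fun G => forall x, is_derive x 1 G (f x)) F dF) x).
have : (antiderivative f - F) b = (antiderivative f - F) a.
  apply: is_derive_0_is_cst => x; have dx := dA x; have dFx := dF x.
  by apply: is_derive_eq; rewrite subrr.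
by rewrite !fctE => E; lra.
Qed.

Lemma antiderivativeP f : continuous f -> forall x, is_derive x 1 (antiderivative f) (f x).
Proof.
move=> /antiderivative_ex [F dF]; rewrite /antiderivative.
exact: (xgetPex (fun=> 0) (ex_intro (fun G => forall x, is_derive x 1 G (f x)) F dF)).
Qed.

Lemma rint_bound f a b M : continuous f -> a <= b ->
  (forall x, a <= x <= b -> `|f x| <= M) -> `|rint f a b| <= M * (b - a).
Proof.
move=> fc ab fM; apply: (@derive_bound f) => // x _; exact: antiderivativeP.
Qed.

Lemma rint_lin f g (p q : R) a b : continuous f -> continuous g ->
  rint (fun x => p * f x + q * g x) a b = p * rint f a b + q * rint g a b.
Proof.
move=> fc gc.
have d x : is_derive x 1 (p *: antiderivative f + q *: antiderivative g)
    (p * f x + q * g x).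
  exact: (is_deriveD (is_deriveZ p (antiderivativeP fc x)) (is_deriveZ q (antiderivativeP gc x))).
by rewrite (rintE a b d) /rint !fctE /GRing.scale /=; ring.
Qed.

Definition rcont (phi : R -> R[i]) :=
  continuous (fun x => complex.Re (phi x)) /\ continuous (fun x => complex.Im (phi x)).

Definition cint (phi : R -> R[i]) a b : R[i] :=
  Complex (rint (fun x => complex.Re (phi x)) a b) (rint (fun x => complex.Im (phi x)) a b).

Lemma cint_cat phi a b c : cint phi a b + cint phi b c = cint phi a c.
Proof.
rewrite /cint /rint; apply/eqP; rewrite eq_complex /=.
by apply/andP; split; apply/eqP; ring.
Qed.

(** Bounding the real and imaginary parts separately costs the factor 2. It is harmless, since only
    the rate of decay matters in the end. *)
Lemma cint_bound phi a b M : rcont phi -> a <= b ->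
  (forall x, a <= x <= b -> normc (phi x) <= M) -> normc (cint phi a b) <= 2 * M * (b - a).
Proof.
move=> [rc ic] ab pM; apply: le_trans (normc_le_ReIm _) _.
have -> : 2 * M * (b - a) = M * (b - a) + M * (b - a) by ring.
apply: lerD; apply: rint_bound => // x /pM; apply: le_trans.
  exact: Re_le_normc.
exact: Im_le_normc.
Qed.

Lemma rcontD phi psi : rcont phi -> rcont psi -> rcont (fun x => phi x + psi x).
Proof.
move=> [p1 p2] [q1 q2]; split => x; under eq_fun do rewrite raddfD /=.
  by apply: cvgD; [exact: p1|exact: q1].
by apply: cvgD; [exact: p2|exact: q2].
Qed.

Lemma rcontZ (k : R[i]) phi : rcont phi -> rcont (fun x => k * phi x).
Proof.
move=> [p1 p2]; split => x.
  have -> : (fun x => complex.Re (k * phi x)) = (fun x => complex.Re k * complex.Re (phi x) - complex.Im k * complex.Im (phi x)).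
    by apply/funext => y; case: k (phi y) => k1 k2 [].
  by apply: cvgB; apply: cvgM; do ?[exact: cvg_cst|exact: p1|exact: p2].
have -> : (fun x => complex.Im (k * phi x)) = (fun x => complex.Re k * complex.Im (phi x) + complex.Im k * complex.Re (phi x)).
  by apply/funext => y; case: k (phi y) => k1 k2 [].
by apply: cvgD; apply: cvgM; do ?[exact: cvg_cst|exact: p1|exact: p2].
Qed.

Lemma cintD phi psi a b : rcont phi -> rcont psi ->
  cint (fun x => phi x + psi x) a b = cint phi a b + cint psi a b.
Proof.
move=> [p1 p2] [q1 q2]; apply/eqP; rewrite eq_complex /=; apply/andP; split; apply/eqP.
  rewrite -[X in X + _]mul1r -[X in _ + X]mul1r -rint_lin //.
  by congr (rint _ _ _); apply/funext => x; rewrite !mul1r; case: (phi x) (psi x) => ? ? [].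
rewrite -[X in X + _]mul1r -[X in _ + X]mul1r -rint_lin //.
by congr (rint _ _ _); apply/funext => x; rewrite !mul1r; case: (phi x) (psi x) => ? ? [].
Qed.

Lemma cintZ (k : R[i]) phi a b : rcont phi ->
  cint (fun x => k * phi x) a b = k * cint phi a b.
Proof.
move=> [p1 p2]; case: k => k1 k2; apply/eqP; rewrite eq_complex /=.
apply/andP; split; apply/eqP.
  rewrite -mulNr -rint_lin //.
  by congr (rint _ _ _); apply/funext => x; case: (phi x) => ? ? /=; ring.
rewrite -rint_lin //.
by congr (rint _ _ _); apply/funext => x; case: (phi x) => ? ? /=; ring.
Qed.

Lemma cint_sum (I : Type) (r : seq I) (P : pred I) (phi : I -> R -> R[i]) a b :
  (forall i, rcont (phi i)) ->
  rcont (fun x => \sum_(i <- r | P i) phi i x) /\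
  cint (fun x => \sum_(i <- r | P i) phi i x) a b = \sum_(i <- r | P i) cint (phi i) a b.
Proof.
move=> pc; have c0 : rcont (fun=> 0) by split => x; exact: cvg_cst.
elim: r => [|i r [IH1 IH2]].
  under eq_fun do rewrite big_nil; rewrite big_nil; split => //.
  have d x : is_derive x 1 (fun=> 0 : R) (0 : R) by exact: is_derive_cst.
  by rewrite /cint /= (rintE a b d) subrr.
rewrite big_cons; case: ifP => Pi.
  under eq_fun do rewrite big_cons Pi.
  by split; [exact: rcontD|rewrite cintD // IH2].
by under eq_fun do rewrite big_cons Pi.
Qed.

(** Goursat's argument has to see that the contour integral of a first-order Taylor polynomial
    vanishes; explicit values on the sides make this an identity. *)
Lemma cint_affine (p q : R[i]) a b :
  cint (fun x => p + q * (x%:C)%C) a b =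
  (p * (b - a)%:C + q * ((b ^+ 2 - a ^+ 2) / 2)%:C)%C.
Proof.
case: p q => [p1 p2] [q1 q2].
have K (u v : R) : rint (fun x => u + v * x) a b = u * (b - a) + v * ((b ^+ 2 - a ^+ 2) / 2).
  have d x : is_derive x 1 (u *: id + (v / 2) *: id ^+ 2) (u + v * x).
    have dX := is_deriveX 2 (is_derive_id x 1).
    have [dh hE] := is_deriveD (is_deriveZ u (is_derive_id x 1)) (is_deriveZ (v / 2) dX).
    by apply: DeriveDef => //; rewrite hE /GRing.scale /=; field.
  by rewrite (rintE a b d) !fctE /GRing.scale /=; field.
rewrite /cint; apply/eqP; rewrite eq_complex /=; apply/andP; split; apply/eqP.
  transitivity (rint (fun x => p1 + q1 * x) a b); last by rewrite K; ring.
  by congr (rint _ _ _); apply/funext => x; ring.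
transitivity (rint (fun x => p2 + q2 * x) a b); last by rewrite K; ring.
by congr (rint _ _ _); apply/funext => x; ring.
Qed.

Lemma rcont_affine (p q : R[i]) : rcont (fun x => p + q * (x%:C)%C).
Proof.
apply: rcontD; first by split => x; exact: cvg_cst.
by apply: rcontZ; split => x /=; [exact: cvg_id | exact: cvg_cst].
Qed.

End Integral.

(** * Goursat's theorem on rectangles *)

Section Goursat.
Variable R : realType.
Local Notation C := R[i].
Local Notation normc := (@ComplexField.Normc.normc R).

(** Differentiability in the complex variable x + iy: the single factor d encodes the Cauchy-Riemann
    equations. Squares and the l1 norm fit the rectangles to come. *)
Definition cdiff2 (G : R -> R -> C) (x y : R) := exists d : C, forall e, 0 < e ->
  exists2 dl, 0 < dl & forall x' y', `|x' - x| < dl -> `|y' - y| < dl ->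
    normc (G x' y' - G x y - d * Complex (x' - x) (y' - y)) <= e * (`|x' - x| + `|y' - y|).

Variable G : R -> R -> C.
Hypothesis G1 : forall y, rcont (fun x => G x y).
Hypothesis G2 : forall x, rcont (G x).

(* The contour integral over the boundary of [[a, b] x [c, d]], counterclockwise. *)
Definition rect_int a b c d : C :=
  cint (fun x => G x c) a b - cint (fun x => G x d) a b
  + (Complex 0 1) * (cint (G b) c d - cint (G a) c d).

(** The Taylor polynomial integrates to zero around the rectangle, so only the remainder counts. It
    is at most e times the half-perimeter, and the four sides together contribute another 4
    half-perimeters. *)
Lemma rect_int_local x0 y0 a b c d dl e (D : C) :
  a <= x0 <= b -> c <= y0 <= d -> b - a < dl -> d - c < dl ->
  (forall x' y', `|x' - x0| < dl -> `|y' - y0| < dl ->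
    normc (G x' y' - G x0 y0 - D * Complex (x' - x0) (y' - y0)) <= e * (`|x' - x0| + `|y' - y0|)) ->
  0 < e -> normc (rect_int a b c d) <= 4 * e * (b - a + (d - c)) ^+ 2.
Proof.
move=> ax cy ba dc GD e0.
pose i : C := Complex 0 1.
pose L x y : C := G x0 y0 + D * Complex (x - x0) (y - y0).
have Lx y : (fun x => L x y) = (fun x => (G x0 y0 + D * Complex (- x0) (y - y0)) + D * (x%:C)%C).
  apply/funext => x; rewrite /L -addrA -mulrDr; congr (_ + D * _).
  by apply/eqP; rewrite eq_complex /= addr0 addrC !eqxx.
have Ly x : L x = (fun y => (G x0 y0 + D * Complex (x - x0) (- y0)) + (D * i) * (y%:C)%C).
  apply/funext => y; rewrite /L -addrA -mulrA -mulrDr; congr (_ + D * _).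
  by apply/eqP; rewrite eq_complex /=; apply/andP; split; apply/eqP; ring.
have cLx y : rcont (fun x => L x y) by rewrite Lx; exact: rcont_affine.
have cLy x : rcont (L x) by rewrite Ly; exact: rcont_affine.
have L0 : cint (fun x => L x c) a b - cint (fun x => L x d) a b
    + i * (cint (L b) c d - cint (L a) c d) = 0.
  rewrite !Lx !Ly !cint_affine; case: (G x0 y0) D {GD L Lx Ly cLx cLy} => g1 g2 [d1 d2].
  by apply/eqP; rewrite eq_complex /=; apply/andP; split; apply/eqP; field.
have bnd x y : a <= x <= b -> c <= y <= d -> normc (G x y + -1 * L x y) <= e * (b - a + (d - c)).
  move=> xab ycd; rewrite mulN1r /L opprD addrA.
  apply: le_trans (GD _ _ _ _) _; try by rewrite ltr_norml; lra.
  by rewrite ler_pM2l //; apply: lerD; rewrite ler_norml; lra.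
have E : rect_int a b c d =
    cint (fun x => G x c + -1 * L x c) a b - cint (fun x => G x d + -1 * L x d) a b
    + i * (cint (fun y => G b y + -1 * L b y) c d - cint (fun y => G a y + -1 * L a y) c d).
  rewrite !cintD ?cintZ //; try exact: rcontZ.
  rewrite -[LHS]subr0 -[X in _ - X]L0 /rect_int -/i; ring.
have ab : a <= b by lra.
have cd : c <= d by lra.
have cx y : rcont (fun x => G x y + -1 * L x y) by apply: rcontD => //; exact: rcontZ.
have cy' x : rcont (fun y => G x y + -1 * L x y) by apply: rcontD => //; exact: rcontZ.
have b1 : normc (cint (fun x => G x c + -1 * L x c) a b) <= 2 * (e * (b - a + (d - c))) * (b - a).
  by apply: cint_bound => // x xab; apply: bnd => //; rewrite lexx.
have b2 : normc (cint (fun x => G x d + -1 * L x d) a b) <= 2 * (e * (b - a + (d - c))) * (b - a).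
  by apply: cint_bound => // x xab; apply: bnd => //; rewrite lexx andbT.
have b3 : normc (cint (fun y => G b y + -1 * L b y) c d) <= 2 * (e * (b - a + (d - c))) * (d - c).
  by apply: cint_bound => // y ycd; apply: bnd => //; rewrite lexx andbT.
have b4 : normc (cint (fun y => G a y + -1 * L a y) c d) <= 2 * (e * (b - a + (d - c))) * (d - c).
  by apply: cint_bound => // y ycd; apply: bnd => //; rewrite lexx.
rewrite E; apply: le_trans (normcD _ _) _.
have ni : normc i = 1 by rewrite /i /= expr0n /= expr1n add0r sqrtr1.
rewrite ComplexField.Normc.normcM ni mul1r.
apply: le_trans (lerD (normcB _ _) (normcB _ _)) _.
apply: le_trans (lerD (lerD b1 b2) (lerD b3 b4)) _.
by rewrite le_eqVlt; apply/orP; left; apply/eqP; ring.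
Qed.

Lemma rect_int_split a b c d (x y : R) :
  rect_int a b c d = rect_int a x c y + rect_int x b c y
    + (rect_int a x y d + rect_int x b y d).
Proof.
rewrite /rect_int -(cint_cat (fun z => G z c) a x b) -(cint_cat (fun z => G z d) a x b).
rewrite -(cint_cat (G a) c y d) -(cint_cat (G b) c y d); ring.
Qed.

(** Integrals over inner edges cancel, so the integral is the sum over four quarters and one of them
    carries at least a quarter of the modulus. *)
Lemma rect_int_bisect a c w h m : m <= normc (rect_int a (a + w) c (c + h)) ->
  exists2 p : R * R, (p.1 = a \/ p.1 = a + w / 2) /\ (p.2 = c \/ p.2 = c + h / 2) &
    m / 4 <= normc (rect_int p.1 (p.1 + w / 2) p.2 (p.2 + h / 2)).
Proof.
rewrite (rect_int_split a (a + w) c (c + h) (a + w / 2) (c + h / 2)) => H.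
have Ew : a + w / 2 + w / 2 = a + w by field.
have Eh : c + h / 2 + h / 2 = c + h by field.
have {}H := le_trans H (le_trans (normcD _ _) (lerD (normcD _ _) (normcD _ _))).
have [h1|h1] := leP (m / 4) (normc (rect_int a (a + w / 2) c (c + h / 2))).
  by exists (a, c) => //=; tauto.
have [h2|h2] := leP (m / 4) (normc (rect_int (a + w / 2) (a + w) c (c + h / 2))).
  by exists (a + w / 2, c) => /=; [tauto|rewrite Ew].
have [h3|h3] := leP (m / 4) (normc (rect_int a (a + w / 2) (c + h / 2) (c + h))).
  by exists (a, c + h / 2) => /=; [tauto|rewrite Eh].
have [h4|h4] := leP (m / 4) (normc (rect_int (a + w / 2) (a + w) (c + h / 2) (c + h))).
  by exists (a + w / 2, c + h / 2) => /=; [tauto|rewrite Ew Eh].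
lra.
Qed.

Lemma nested_limit (u : nat -> R) (w : R) : 0 <= w ->
  (forall k, u k <= u k.+1 /\ u k.+1 + w / 2 ^+ k.+1 <= u k + w / 2 ^+ k) ->
  exists x, forall k, u k <= x <= u k + w / 2 ^+ k.
Proof.
move=> w0 H.
have w0k k : 0 <= w / 2 ^+ k by rewrite divr_ge0 // exprn_ge0.
have up k j : u k <= u (k + j)%N.
  by elim: j => [|j IH]; rewrite ?addn0 // addnS; apply: le_trans IH (H _).1.
have dn k j : u (k + j)%N + w / 2 ^+ (k + j) <= u k + w / 2 ^+ k.
  by elim: j => [|j IH]; rewrite ?addn0 // addnS; apply: le_trans (H _).2 IH.
have ub k j : u j <= u k + w / 2 ^+ k.
  have [kj|/ltnW jk] := leqP k j.
    have := dn k (j - k)%N; rewrite subnKC //; apply: le_trans.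
    by rewrite lerDl.
  have := up j (k - j)%N; rewrite subnKC // => /le_trans; apply.
  by rewrite lerDl.
have hs : has_sup (range u).
  by split; [exists (u 0%N), 0%N|exists (u 0%N + w / 2 ^+ 0) => _ [j _ <-]; apply: ub].
exists (sup (range u)) => k; apply/andP; split.
  by apply: ub_le_sup; [exact: hs.2|exists k].
by apply: ge_sup; [exact: hs.1|move=> _ [j _ <-]; apply: ub].
Qed.

(** Repeated bisection gives rectangles that shrink to a point and whose integrals are at least m /
    4^k. The local bound there is 4e((w + h) / 2^k)^2, the powers of 4 cancel, and e is
    arbitrary. *)
Lemma goursat a c w h : 0 < w -> 0 < h ->
  (forall x y, a <= x <= a + w -> c <= y <= c + h -> cdiff2 G x y) ->
  rect_int a (a + w) c (c + h) = 0.
Proof.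
move=> w0 h0 GD; apply: ComplexField.Normc.eq0_normc; apply/eqP.
rewrite eq_le normc_ge0 andbT; set m := normc _.
(* Stating the bound as a premise makes the bisection step total, so that [choice] yields one
   function to iterate from the corner (a, c). *)
have step (s : nat * (R * R)) : exists p : R * R,
    m / 4 ^+ s.1 <= normc (rect_int s.2.1 (s.2.1 + w / 2 ^+ s.1) s.2.2 (s.2.2 + h / 2 ^+ s.1)) ->
    [/\ p.1 = s.2.1 \/ p.1 = s.2.1 + w / 2 ^+ s.1.+1,
        p.2 = s.2.2 \/ p.2 = s.2.2 + h / 2 ^+ s.1.+1 &
    m / 4 ^+ s.1.+1 <= normc (rect_int p.1 (p.1 + w / 2 ^+ s.1.+1) p.2 (p.2 + h / 2 ^+ s.1.+1))].
  case: s => k [x y] /=.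
  have E z n : z / n ^+ k.+1 = z / n ^+ k / n :> R by rewrite exprSr invfM mulrA mulrAC.
  case: (leP (m / 4 ^+ k) (normc (rect_int x (x + w / 2 ^+ k) y (y + h / 2 ^+ k)))).
    by move=> /rect_int_bisect [p [p1 p2] pm]; exists p => _; rewrite !E.
  by move=> _; exists (x, y).
have [nx nxP] := choice step.
pose s := fix s k := if k is k'.+1 then nx (k', s k') else (a, c).
have sm k : m / 4 ^+ k <= normc (rect_int (s k).1 ((s k).1 + w / 2 ^+ k) (s k).2 ((s k).2 + h / 2 ^+ k)).
  elim: k => [|k IH]; first by rewrite !expr0 !divr1.
  by have [_ _] := nxP (k, s k) IH.
have half z k : z / 2 ^+ k = z / 2 ^+ k.+1 + z / 2 ^+ k.+1 :> R.
  by rewrite exprSr; field; rewrite expf_neq0 // pnatr_eq0.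
have w0k k : 0 < w / 2 ^+ k by rewrite divr_gt0 // exprn_gt0.
have h0k k : 0 < h / 2 ^+ k by rewrite divr_gt0 // exprn_gt0.
have [x0 x0P] : exists x, forall k, (s k).1 <= x <= (s k).1 + w / 2 ^+ k.
  apply: nested_limit (ltW w0) _ => k; have [+ _ _] := nxP (k, s k) (sm k).
  by rewrite /= (half w k) => -[] ->; have := w0k k.+1; lra.
have [y0 y0P] : exists x, forall k, (s k).2 <= x <= (s k).2 + h / 2 ^+ k.
  apply: nested_limit (ltW h0) _ => k; have [_ + _] := nxP (k, s k) (sm k).
  by rewrite /= (half h k) => -[] ->; have := h0k k.+1; lra.
have x00 := x0P 0%N; have y00 := y0P 0%N; rewrite /= expr0 !divr1 in x00 y00.
have [D HD] := GD _ _ x00 y00.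
suff H e : 0 < e -> m <= 4 * e * (w + h) ^+ 2.
  apply/ler_addgt0Pl => e e0; rewrite addr0.
  have p : 0 < (w + h) ^+ 2 by rewrite exprn_gt0 // addr_gt0.
  apply: le_trans (H (e / (4 * (w + h) ^+ 2)) _) _; first by rewrite divr_gt0 // mulr_gt0.
  by rewrite le_eqVlt; apply/orP; left; apply/eqP; field; rewrite gt_eqF // addr_gt0.
move=> e0; have [dl dl0 Hdl] := HD e e0.
have [k kP] : exists k, (w + h) / 2 ^+ k < dl.
  exists (Num.truncn ((w + h) / dl)).+1; rewrite ltr_pdivrMr ?exprn_gt0 // mulrC.
  rewrite -ltr_pdivrMr //; apply: lt_trans (truncnS_gt _) _.
  by rewrite -natrX ltr_nat ltn_expl.
have := le_trans (sm k) (rect_int_local (x0P k) (y0P k) _ _ Hdl e0).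
have wk := w0k k; have hk := h0k k; rewrite mulrDl in kP.
have -> : (s k).1 + w / 2 ^+ k - (s k).1 = w / 2 ^+ k by ring.
have -> : (s k).2 + h / 2 ^+ k - (s k).2 = h / 2 ^+ k by ring.
have wd : w / 2 ^+ k < dl by lra.
have hd : h / 2 ^+ k < dl by lra.
move=> /(_ wd hd); rewrite -mulrDl exprMn exprVn -exprM mulnC exprM.
have -> : (2 : R) ^+ 2 = 4 by ring.
by rewrite mulrA ler_pM2r // invr_gt0 exprn_gt0.
Qed.

End Goursat.

(** * The complex exponential and circle integrals *)

Section Exponential.
Variable R : realType.
Local Notation C := R[i].
Local Notation normc := (@ComplexField.Normc.normc R).

(* [cexp s t] is the complex exponential of [s + i t]. *)
Definition cexp (s t : R) : C := Complex (expR s * cos t) (expR s * sin t).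

Lemma cexpD s t s' t' : cexp (s + s') (t + t') = cexp s t * cexp s' t'.
Proof.
apply/eqP; rewrite /cexp eq_complex /= expRD cosD sinD.
by apply/andP; split; apply/eqP; ring.
Qed.

Lemma cexp0 : cexp 0 0 = 1.
Proof. by rewrite /cexp expR0 cos0 sin0 mulr1 mulr0. Qed.

Lemma cexpX s t k : cexp s t ^+ k = cexp (s *+ k) (t *+ k).
Proof.
by elim: k => [|k IH]; rewrite ?expr0 ?mulr0n ?cexp0 // exprS IH !mulrS cexpD.
Qed.

Lemma normc_cexp s t : normc (cexp s t) = expR s.
Proof.
rewrite /cexp /= !exprMn -mulrDr cos2Dsin2 mulr1 sqrtr_sqr.
by rewrite ger0_norm // expR_ge0.
Qed.

Lemma cexp_neq0 s t : cexp s t != 0.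
Proof.
apply/eqP => E; have := normc_cexp s t; rewrite E ComplexField.Normc.normc0.
by move/eqP; rewrite eq_sym expR_eq0.
Qed.

Lemma cexp2pi s : cexp s (pi *+ 2) = cexp s 0.
Proof. by rewrite /cexp cos2pi sin2pi cos0 sin0. Qed.

Lemma real_derive_eps (f : R -> R) (x d : R) : is_derive x 1 f d ->
  forall e, 0 < e -> exists2 dl, 0 < dl & forall h, `|h| < dl ->
    `|f (x + h) - f x - d * h| <= e * `|h|.
Proof.
move=> [/cvg_ex [l /= fl] fd] e e0.
have ld : l = d by rewrite -fd; apply/esym/cvg_lim.
move: fl => /cvgrPdist_le /(_ _ e0) [dl /= dl0 H].
exists dl => // h hd; have [->|h0] := eqVneq h 0.
  by rewrite addr0 subrr mulr0 subrr normr0 mulr0.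
have := H h; rewrite /ball_ /= sub0r normrN => /(_ hd h0).
rewrite /GRing.scale /= mulr1 ld => H1.
have -> : f (x + h) - f x - d * h = - ((d - h^-1 * (f (h + x) - f x)) * h).
  by rewrite [x + h]addrC; field.
by rewrite normrN normrM ler_wpM2r.
Qed.

Lemma cexp_diff0 e : 0 < e -> exists2 dl, 0 < dl & forall a b, `|a| < dl -> `|b| < dl ->
  normc (cexp a b - 1 - Complex a b) <= e * (`|a| + `|b|).
Proof.
(* The error splits into four products whose coefficients of n sum to at most 1 for [|a|] and 2 + 2
   + 1 = 5 for [|b|]. The bound n <= 1 and the radius n / 2 give [|expR a - 1| <= n]. *)
move=> e0; pose n := Num.min 1 (e / 5).
have n0 : 0 < n by rewrite lt_min ltr01 divr_gt0.
have n1 : n <= 1 by rewrite ge_min lexx.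
have ne : n <= e / 5 by rewrite ge_min lexx orbT.
have [d1 d10 H1] := real_derive_eps (is_derive_expR (0 : R)) n0.
have [d2 d20 H2] := real_derive_eps (is_derive_cos (0 : R)) n0.
have [d3 d30 H3] := real_derive_eps (is_derive_sin (0 : R)) n0.
exists (Num.min (Num.min d1 d2) (Num.min d3 (n / 2))).
  by rewrite !lt_min d10 d20 d30 divr_gt0.
move=> a b; rewrite !lt_min => /andP[/andP[a1 _] /andP[_ an]] /andP[/andP[_ b2] /andP[b3 _]].
have {H1} := H1 a a1; rewrite add0r expR0 mul1r => H1.
have {H2} := H2 b b2; rewrite add0r cos0 sin0 oppr0 mul0r subr0 => H2.
have {H3} := H3 b b3; rewrite add0r cos0 sin0 mul1r subr0 => H3.
have A0 := normr_ge0 a; have B0 := normr_ge0 b.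
have Ea : `|expR a - 1| <= n.
  have := ler_normD (expR a - 1 - a) a; rewrite subrK; nra.
have Ea2 : `|expR a| <= 2.
  by have := ler_normD (expR a - 1) 1; rewrite subrK normr1; lra.
apply: le_trans (normc_le_ReIm _) _; rewrite /cexp /= oppr0 addr0.
have -> : expR a * cos b - 1 - a = (expR a - 1 - a) + expR a * (cos b - 1) by ring.
have -> : expR a * sin b - b = expR a * (sin b - b) + (expR a - 1) * b by ring.
apply: le_trans (lerD (ler_normD _ _) (ler_normD _ _)) _; rewrite !normrM.
have P1 : `|expR a| * `|cos b - 1| <= 2 * (n * `|b|) by apply: ler_pM.
have P2 : `|expR a| * `|sin b - b| <= 2 * (n * `|b|) by apply: ler_pM.
have P3 : `|expR a - 1| * `|b| <= n * `|b| by apply: ler_wpM2r.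
nra.
Qed.

Lemma cexp_diff s t e : 0 < e ->
  exists2 dl, 0 < dl & forall s' t', `|s' - s| < dl -> `|t' - t| < dl ->
  normc (cexp s' t' - cexp s t - cexp s t * Complex (s' - s) (t' - t))
    <= e * (`|s' - s| + `|t' - t|).
Proof.
move=> e0; have [|dl dl0 H] := @cexp_diff0 (e / expR s); first by rewrite divr_gt0 ?expR_gt0.
exists dl => // s' t' /H{}H /H{}H.
have -> : cexp s' t' = cexp s t * cexp (s' - s) (t' - t).
  by rewrite -cexpD; congr cexp; ring.
rewrite -[X in _ * _ - X - _]mulr1 -!mulrBr ComplexField.Normc.normcM normc_cexp.
apply: le_trans (ler_wpM2l (expR_ge0 s) H) _.
rewrite mulrA [expR s * _]mulrC divfK // gt_eqF // expR_gt0 //.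
Qed.

Definition ccont2 (G : R -> R -> C) (x y : R) := forall e, 0 < e ->
  exists2 dl, 0 < dl & forall x' y', `|x' - x| < dl -> `|y' - y| < dl ->
    normc (G x' y' - G x y) < e.

Lemma cexp_lip s t : exists2 dl, 0 < dl & exists2 L, 0 < L &
  forall s' t', `|s' - s| < dl -> `|t' - t| < dl ->
  normc (cexp s' t' - cexp s t) <= L * (`|s' - s| + `|t' - t|).
Proof.
have [dl dl0 H] := cexp_diff s t ltr01; exists dl => //.
exists (1 + expR s); first by rewrite addr_gt0 ?expR_gt0.
move=> s' t' /H{}H /H{}H.
set D := _ * Complex _ _ in H.
rewrite -[X in normc X](subrK D); apply: le_trans (normcD _ _) _.
rewrite mulrDl; apply: lerD => //.
rewrite /D ComplexField.Normc.normcM normc_cexp ler_wpM2l ?expR_ge0 //.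
exact: normc_le_ReIm.
Qed.

Lemma ccont2_cexp Q s t : ccont Q (cexp s t) -> ccont2 (fun s t => Q (cexp s t)) s t.
Proof.
move=> Qc e e0; have [dl dl0 H] := Qc e e0.
have [d1 d10 [L L0 HL]] := cexp_lip s t.
exists (Num.min d1 (dl / (2 * L))); first by rewrite lt_min d10 divr_gt0 // mulr_gt0.
move=> s' t'; rewrite !lt_min => /andP[s1 s2] /andP[t1 t2]; apply: H.
apply: le_lt_trans (HL _ _ s1 t1) _.
have -> : dl = L * (dl / (2 * L) + dl / (2 * L)) by field; rewrite gt_eqF.
by rewrite ltr_pM2l // ltrD.
Qed.

Lemma cdiff2_cexp Q s t : cdiff Q (cexp s t) -> cdiff2 (fun s t => Q (cexp s t)) s t.
Proof.
move=> [D HD]; exists (D * cexp s t) => e e0.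
have [d1 d10 [L L0 HL]] := cexp_lip s t.
have [|d2 d20 H2] := HD (e / (2 * L)); first by rewrite divr_gt0 // mulr_gt0.
have ND : 0 < normc D + 1 by rewrite ltr_wpDl // normc_ge0.
have [|d3 d30 H3] := @cexp_diff s t (e / (2 * (normc D + 1))).
  by rewrite divr_gt0 // mulr_gt0.
exists (Num.min d1 (Num.min d3 (d2 / (2 * L)))).
  by rewrite !lt_min d10 d30 divr_gt0 // mulr_gt0.
move=> s' t'; rewrite !lt_min => /and3P[s1 s3 s2] /and3P[t1 t3 t2].
have {}HL := HL _ _ s1 t1.
have uu : normc (cexp s' t' - cexp s t) < d2.
  apply: le_lt_trans HL _.
  have -> : d2 = L * (d2 / (2 * L) + d2 / (2 * L)) by field; rewrite gt_eqF.
  by rewrite ltr_pM2l // ltrD.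
have {}H2 := H2 _ uu; have {}H3 := H3 _ _ s3 t3.
set z := Complex _ _ in H3 *; set S := `|s' - s| + `|t' - t| in H3 HL *.
have S0 : 0 <= S by rewrite addr_ge0.
have -> : Q (cexp s' t') - Q (cexp s t) - D * cexp s t * z =
  (Q (cexp s' t') - Q (cexp s t) - D * (cexp s' t' - cexp s t))
   + D * (cexp s' t' - cexp s t - cexp s t * z) by ring.
apply: le_trans (normcD _ _) _; rewrite ComplexField.Normc.normcM.
have P1 : e / (2 * L) * normc (cexp s' t' - cexp s t) <= e / 2 * S.
  have -> : e / 2 * S = e / (2 * L) * (L * S) by field; rewrite gt_eqF.
  by rewrite ler_wpM2l // divr_ge0 ?ltW // mulr_gt0.
have P2 : normc D * normc (cexp s' t' - cexp s t - cexp s t * z) <= e / 2 * S.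
  have -> : e / 2 * S = (normc D + 1) * (e / (2 * (normc D + 1)) * S).
    by field; rewrite gt_eqF.
  by apply: ler_pM; rewrite ?normc_ge0 // lerDl.
have -> : e * S = e / 2 * S + e / 2 * S by field.
by apply: lerD => //; apply: le_trans P1.
Qed.

Lemma ccont2_rcont1 (G : R -> R -> C) y : (forall x, ccont2 G x y) -> rcont (fun x => G x y).
Proof.
move=> Gc; split => x; apply/cvgrPdist_lt => e e0; have [dl dl0 H] := Gc x e e0.
  near=> z; rewrite -raddfB /=; apply: le_lt_trans (Re_le_normc _) _.
  rewrite normc_dist; apply: H; last by rewrite subrr normr0.
  by rewrite distrC; near: z; apply: cvgr_dist_lt; [exact: cvg_id|].
near=> z; rewrite -raddfB /=; apply: le_lt_trans (Im_le_normc _) _.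
rewrite normc_dist; apply: H; last by rewrite subrr normr0.
by rewrite distrC; near: z; apply: cvgr_dist_lt; [exact: cvg_id|].
Unshelve. all: by end_near. Qed.

Lemma ccont2_rcont2 (G : R -> R -> C) x : (forall y, ccont2 G x y) -> rcont (G x).
Proof.
move=> Gc; apply: (@ccont2_rcont1 (fun y x => G x y)) => y e e0.
by have [dl dl0 H] := Gc y e e0; exists dl => // *; apply: H.
Qed.

(** Compactness of the segment in y makes joint continuity along x = 0 uniform; this lets circle
    integrals pass to the limit at the unit circle. *)
Lemma ccont2_unif (G : R -> R -> C) a b e : (forall y, ccont2 G 0 y) -> 0 < e ->
  exists2 dl, 0 < dl & forall x y, `|x| < dl -> a <= y <= b -> normc (G x y - G 0 y) < e.
Proof.
move=> Gc e0.
have := (compact_near_coveringP _).1 (@segment_compact R a b) R (nbhs (0 : R))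
  (fun x y => normc (G x y - G 0 y) < e) _.
case=> [y _|dl /= dl0 H].
  have e2 : 0 < e / 2 by rewrite divr_gt0.
  have [dl dl0 H] := Gc y _ e2.
  exists (ball y dl, ball 0 dl) => /=; first by split; exact: nbhsx_ballx.
  move=> [y' x'] /= [yy xx]; rewrite /ball /= in yy xx.
  have x1 : `|x' - 0| < dl by rewrite distrC.
  have y1 : `|y' - y| < dl by rewrite distrC.
  have H1 := H _ _ x1 y1.
  have := H 0 y'; rewrite subrr normr0 => /(_ dl0 y1) H2.
  have -> : G x' y' - G 0 y' = (G x' y' - G 0 y) - (G 0 y' - G 0 y) by ring.
  by apply: le_lt_trans (normcB _ _) _; lra.
exists dl => // x y xd yab; apply: H => //=.
by rewrite sub0r normrN.
Qed.

(** Integration is against the angle, that is against du/(iu), so the value is 2 pi times the mean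
    over the circle of radius exp(s). *)
Definition circle_int (Q : C -> C) s : C := cint (fun t => Q (cexp s t)) 0 (pi *+ 2).

(** In the variable s + it the annulus becomes a rectangle whose sides t = 0 and t = 2 pi cancel by
    periodicity, so Goursat equates the other two. Differentiability is not assumed at s = 0,
    because [Q] will contain a difference quotient at a point of the unit circle. *)
Lemma circle_int_const (Q : C -> C) (r : R) : 0 < r ->
  (forall s t, `|s| <= r -> ccont Q (cexp s t)) ->
  (forall s t, `|s| <= r -> s != 0 -> cdiff Q (cexp s t)) ->
  forall s, `|s| < r -> circle_int Q s = circle_int Q 0.
Proof.
move=> r0 Qc Qd.
(* Clipping makes the integrands continuous on the whole line. *)
pose clip x := Num.max (- r) (Num.min r x).
have clipE x : `|x| <= r -> clip x = x.
  rewrite ler_norml => /andP[x1 x2]; rewrite /clip (min_idPr x2).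
  exact: (max_idPr x1).
have clipr x : `|clip x| <= r.
  rewrite /clip ler_norml; apply/andP; split; first by rewrite le_max lexx.
  by rewrite ge_max ge_min lexx /=; rewrite andbT; lra.
have clip_lip x y : `|clip x - clip y| <= `|x - y|.
  have N1 := ler_norm (x - y); have N2 := ler_norm (- (x - y)); rewrite normrN in N2.
  rewrite /clip ler_norml; case: (leP r x) => ?; case: (leP r y) => ?;
    by do 2?case: (leP (- r)) => ?; lra.
pose G s t := Q (cexp (clip s) t).
have Gc s t : ccont2 G s t.
  have H := ccont2_cexp (Qc (clip s) t (clipr s)).
  move=> e e0; have [dl dl0 {}H] := H e e0; exists dl => // s' t' s1 t1.
  by apply: H => //; apply: le_lt_trans s1.
have Gd s t : `|s| < r -> s != 0 -> cdiff2 G s t.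
  move=> sr s0; have [D HD] := cdiff2_cexp (Qd s t (ltW sr) s0).
  exists D => e e0; have [dl dl0 {}HD] := HD e e0.
  exists (Num.min dl (r - `|s|)); first by rewrite lt_min dl0 subr_gt0.
  move=> s' t'; rewrite !lt_min => /andP[s1 s2] /andP[t1 t2].
  have s'r : `|s'| <= r by have := ler_normD (s' - s) s; rewrite subrK; lra.
  by rewrite /G !clipE ?(ltW sr) //; apply: HD.
have G1 y : rcont (fun x => G x y) by apply: ccont2_rcont1.
have G2 x : rcont (G x) by apply: ccont2_rcont2.
have CE s : `|s| < r -> circle_int Q s = cint (G s) 0 (pi *+ 2).
  by move=> sr; rewrite /circle_int /G clipE // ltW.
have p0 : 0 < pi *+ 2 :> R by rewrite mulrn_wgt0 // pi_gt0.
(* The disjunction keeps the rectangle on one side of s = 0, where Goursat's hypothesis is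
   available. *)
have Geq a b : a < b -> `|a| < r -> `|b| < r -> (0 < a \/ b < 0) ->
    cint (G a) 0 (pi *+ 2) = cint (G b) 0 (pi *+ 2).
  move=> ab ar br ab0.
  have w0 : 0 < b - a by rewrite subr_gt0.
  have := @goursat R G G1 G2 a 0 (b - a) (pi *+ 2) w0 p0.
  rewrite /rect_int add0r [a + _]addrC subrK.
  have -> : (fun x => G x (pi *+ 2)) = (fun x => G x 0).
    by apply/funext => x; rewrite /G cexp2pi.
  rewrite subrr add0r => H.
  have /eqP : Complex 0 1 * (cint (G b) 0 (pi *+ 2) - cint (G a) 0 (pi *+ 2)) = 0.
    apply: H => x y xab _; apply: Gd; first by move: ar br; rewrite !ltr_norml; lra.
    by apply/eqP => x0; move: xab; rewrite x0; lra.
  rewrite mulf_eq0 => /orP[|]; first by rewrite eq_complex /= oner_eq0 andbF.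
  by rewrite subr_eq0 => /eqP.
have z0 : `|0 : R| < r by rewrite normr0.
move=> s sr; rewrite !CE //.
have [->//|s0] := eqVneq s 0.
apply/eqP; rewrite -subr_eq0; apply/eqP; apply: ComplexField.Normc.eq0_normc.
apply/eqP; rewrite eq_le normc_ge0 andbT; apply/ler_addgt0Pl => e e0; rewrite addr0.
have e1 : 0 < e / (2 * (pi *+ 2)) by rewrite divr_gt0 // mulr_gt0.
have [dl dl0 H] := @ccont2_unif G 0 (pi *+ 2) _ (Gc 0) e1.
(* With the sign of s, [dd] is a parameter between 0 and s: Goursat links it to s, and uniform
   continuity links it to 0. *)
pose dd := Num.min (`|s| / 2) (dl / 2).
have dd0 : 0 < dd by rewrite lt_min !divr_gt0 // normr_gt0.
have dds : dd < `|s|.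
  have : dd <= `|s| / 2 by rewrite ge_min lexx.
  have : 0 < `|s| by rewrite normr_gt0.
  lra.
have ddl : dd < dl.
  have : dd <= dl / 2 by rewrite ge_min lexx orbT.
  lra.
have [s' s'E s'd] : exists2 s', cint (G s) 0 (pi *+ 2) = cint (G s') 0 (pi *+ 2) & `|s'| < dl.
  case: (ltgtP s 0) s0 => // ss _.
    have dds' : dd < - s by rewrite -ltr0_norm.
    exists (- dd); last by rewrite normrN gtr0_norm.
    by apply: Geq; rewrite ?normrN ?(gtr0_norm dd0); [lra|lra|lra|right; lra].
  have dds' : dd < s by rewrite -(gtr0_norm ss).
  exists dd; last by rewrite gtr0_norm.
  by apply/esym; apply: Geq; rewrite ?(gtr0_norm dd0); [lra|lra|lra|left].
rewrite s'E.
have -> : cint (G s') 0 (pi *+ 2) - cint (G 0) 0 (pi *+ 2) =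
   cint (fun t => G s' t + -1 * G 0 t) 0 (pi *+ 2).
  by rewrite cintD ?cintZ ?mulN1r //; apply: rcontZ.
have K (y : R) : 0 < y -> e = 2 * (e / (2 * y)) * (y - 0).
  by move=> y0; field; rewrite gt_eqF.
rewrite [leRHS](K _ p0).
apply: cint_bound; [|exact: ltW|].
  by apply: rcontD => //; apply: rcontZ.
by move=> t tt; rewrite mulN1r ltW // H.
Qed.

End Exponential.

(** * Geometric convergence of Fourier partial sums *)

Section ComplexCalculus.
Variable R : realType.
Local Notation C := R[i].
Local Notation normc := (@ComplexField.Normc.normc R).

Lemma cdiffM (f g : C -> C) u : cdiff f u -> cdiff g u -> cdiff (fun x => f x * g x) u.
Proof.
move=> fd gd; apply: (@differentiable_cdiff _ ((f : (Cx R)^o -> (Cx R)^o) * g)).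
by apply: differentiableM; apply: cdiff_differentiable.
Qed.

Lemma cdiffB (f g : C -> C) u : cdiff f u -> cdiff g u -> cdiff (fun x => f x - g x) u.
Proof.
move=> fd gd; apply: (@differentiable_cdiff _ ((f : (Cx R)^o -> (Cx R)^o) - g)).
by apply: differentiableB; apply: cdiff_differentiable.
Qed.

Lemma cdiff_cst (k : C) u : cdiff (fun=> k) u.
Proof. by apply: (@differentiable_cdiff _ (cst (k : (Cx R)^o))); apply: differentiable_cst. Qed.

Lemma cdiff_id u : cdiff (fun x : C => x) u.
Proof.
by exists 1 => e e0; exists 1 => // v _; rewrite mul1r subrr ComplexField.Normc.normc0 mulr_ge0 ?normc_ge0 // ltW.
Qed.

Lemma cdiffV (f : C -> C) u : f u != 0 -> cdiff f u -> cdiff (fun x => (f x)^-1) u.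
Proof.
move=> f0 fd; apply: (@differentiable_cdiff _ (fun x => (f x : Cx R)^-1)).
by apply: differentiableV => //; apply: cdiff_differentiable.
Qed.

Lemma cdiffX (f : C -> C) n u : cdiff f u -> cdiff (fun x => f x ^+ n) u.
Proof.
elim: n => [|n IH] fd; first by under eq_fun do rewrite expr0; apply: cdiff_cst.
by under eq_fun do rewrite exprS; apply: cdiffM => //; apply: IH.
Qed.

Lemma cdiff_ccont (f : C -> C) u : cdiff f u -> ccont f u.
Proof.
move=> fd; apply: (@continuous_ccont R f).
by apply: differentiable_continuous; apply: cdiff_differentiable.
Qed.

Lemma ccontM (f g : C -> C) u : ccont f u -> ccont g u -> ccont (fun x => f x * g x) u.
Proof.
move=> fc gc e e0.
have F0 := normc_ge0 (f u); have G0 := normc_ge0 (g u).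
have p1 : 0 < e / (2 * (normc (g u) + 1)) by rewrite divr_gt0 // mulr_gt0 //; lra.
have p2 : 0 < Num.min 1 (e / (2 * (normc (f u) + 1))).
  by rewrite lt_min ltr01 divr_gt0 // mulr_gt0 //; lra.
have [d1 d10 H1] := fc _ p1; have [d2 d20 H2] := gc _ p2.
exists (Num.min d1 d2); first by rewrite lt_min d10.
move=> v; rewrite lt_min => /andP[/H1 {}H1 /H2 {}H2].
move: H2; rewrite lt_min => /andP[H2 H3].
have gv : normc (g v) <= normc (g u) + 1.
  by rewrite -[g v](subrK (g u)); apply: le_trans (normcD _ _) _; lra.
have -> : f v * g v - f u * g u = (f v - f u) * g v + f u * (g v - g u) by ring.
apply: le_lt_trans (normcD _ _) _; rewrite !ComplexField.Normc.normcM.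
have A1 : normc (f v - f u) * normc (g v) <= normc (f v - f u) * (normc (g u) + 1).
  by rewrite ler_wpM2l ?normc_ge0.
have A2 : normc (f v - f u) * (normc (g u) + 1) < e / 2.
  by rewrite -ltr_pdivlMr -?mulrA -?invfM // ltr_wpDl.
have A3 : normc (f u) * normc (g v - g u) <= (normc (f u) + 1) * normc (g v - g u).
  by rewrite ler_wpM2r ?normc_ge0 // lerDl.
have A4 : (normc (f u) + 1) * normc (g v - g u) < e / 2.
  by rewrite mulrC -ltr_pdivlMr -?mulrA -?invfM // ltr_wpDl.
lra.
Qed.

Lemma cdiff_local (f g : C -> C) u dl : 0 < dl ->
  (forall v, normc (v - u) < dl -> f v = g v) -> cdiff f u -> cdiff g u.
Proof.
move=> dl0 fg [d H]; exists d => e e0; have [d2 d20 {}H] := H e e0.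
exists (Num.min dl d2); first by rewrite lt_min dl0.
move=> v; rewrite lt_min => /andP[v1 v2]; rewrite -!fg ?H //.
by rewrite subrr ComplexField.Normc.normc0.
Qed.

End ComplexCalculus.

Section FourierApprox.
Variable R : realType.
Local Notation C := R[i].
Local Notation normc := (@ComplexField.Normc.normc R).
Variables (B : C -> C) (r M : R).
Hypothesis r0 : 0 < r.
Hypothesis Bd : forall s t, `|s| <= r -> cdiff B (cexp s t).
Hypothesis BM : forall s t, `|s| <= r -> normc (B (cexp s t)) <= M.

Lemma expR_eq1 (x : R) : (expR x == 1) = (x == 0).
Proof. by rewrite -[X in _ == X]expR0 (inj_eq (@expR_inj R)). Qed.

(** The witness takes the derivative of B as its value at [u0]. This makes it continuous there,
    which is all that the comparison of circles asks for. *)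
Lemma difference_quotient u0 : cdiff B u0 -> exists H : C -> C,
  [/\ forall u, B u - B u0 = H u * (u - u0),
      ccont H u0 & forall u, u != u0 -> cdiff B u -> cdiff H u].
Proof.
move=> [d Bd0]; exists (fun u => if u == u0 then d else (B u - B u0) / (u - u0)).
split.
- move=> u; case: eqP => [->|/eqP uu]; first by rewrite !subrr mulr0.
  by rewrite divfK // subr_eq0.
- move=> e e0; have e2 : 0 < e / 2 by rewrite divr_gt0.
  have [dl dl0 H] := Bd0 _ e2; exists dl => // v vd; rewrite eqxx.
  case: eqP => [_|/eqP vu]; first by rewrite subrr ComplexField.Normc.normc0.
  have vu0 : v - u0 != 0 by rewrite subr_eq0.
  have n0 : 0 < normc (v - u0).
    rewrite lt_neqAle normc_ge0 andbT eq_sym; apply: contra_neq vu0.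
    exact: ComplexField.Normc.eq0_normc.
  rewrite -(ltr_pM2r n0) -ComplexField.Normc.normcM mulrBl divfK //.
  apply: le_lt_trans (H v vd) _; rewrite ltr_pM2r //; lra.
- move=> u uu Bu; have uu0 : u - u0 != 0 by rewrite subr_eq0.
  have n0 : 0 < normc (u - u0).
    rewrite lt_neqAle normc_ge0 andbT eq_sym; apply: contra_neq uu0.
    exact: ComplexField.Normc.eq0_normc.
  apply: (@cdiff_local _ (fun u => (B u - B u0) * (u - u0)^-1) _ _ _ n0).
    move=> v vu; case: eqP => // E; move: vu; rewrite E normc_dist ltxx //.
  apply: cdiffM; first by apply: cdiffB => //; apply: cdiff_cst.
  apply: (@cdiffV _ (fun u => u - u0)) => //.
  by apply: cdiffB; [apply: cdiff_id|apply: cdiff_cst].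
Qed.

Lemma cdiff_monomial p q u : u != 0 -> cdiff (fun u : C => u ^+ p * u^-1 ^+ q) u.
Proof.
move=> u0; apply: cdiffM; first by apply: cdiffX; apply: cdiff_id.
by apply: (@cdiffX _ (fun u => u^-1)); apply: (@cdiffV _ id) => //; apply: cdiff_id.
Qed.

Lemma rcont_circle (Q : C -> C) s : (forall t, ccont Q (cexp s t)) ->
  rcont (fun t => Q (cexp s t)).
Proof.
by move=> Qc; apply: (@ccont2_rcont2 _ (fun s t => Q (cexp s t))) => t; apply: ccont2_cexp.
Qed.

Lemma cexp_split s t : cexp s t = cexp s 0 * cexp 0 t :> C.
Proof. by rewrite -cexpD addr0 add0r. Qed.

(* Invariance of the mean under rescaling of the circle forces it to vanish. *)
Lemma circle_int_monomial p q :
  circle_int (fun u : C => u ^+ p * u^-1 ^+ q) 0 = if p == q then ((pi *+ 2)%:C)%C else 0.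
Proof.
set Q := fun u : C => _.
have Qd s t : cdiff Q (cexp s t) by apply: cdiff_monomial; apply: cexp_neq0.
case: eqP => [pq|/eqP pq].
  rewrite /circle_int (_ : (fun t => _) = fun t => 1 + 0 * (t%:C)%C).
    by rewrite cint_affine mul1r mul0r addr0 subr0.
  by apply/funext => t; rewrite /Q pq mul0r addr0 -exprMn divff ?expr1n // cexp_neq0.
have h := @circle_int_const R Q 2 _ (fun s t _ => cdiff_ccont (Qd s t)) (fun s t _ _ => Qd s t) 1.
have {h} : circle_int Q 1 = circle_int Q 0 by apply: h => //; rewrite normr1; lra.
have E : circle_int Q 1 = Q (cexp 1 0) * circle_int Q 0.
  rewrite /circle_int -cintZ; last by apply: rcont_circle => t; apply: cdiff_ccont.
  by congr cint; apply/funext => t; rewrite /Q (cexp_split 1) !invfM !exprMn; ring.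
rewrite E => /eqP; rewrite -subr_eq0 -[X in _ - X]mul1r -mulrBl mulf_eq0 subr_eq0.
case/orP => [/eqP F|/eqP //]; exfalso.
have : normc (Q (cexp 1 0)) = 1 by rewrite F ComplexField.Normc.normc1.
rewrite /Q ComplexField.Normc.normcM !normcX ComplexField.Normc.normcV normc_cexp.
rewrite -expRN -!expRM_natl -expRD => /eqP; rewrite expR_eq1 mulrN !mulr1 subr_eq0.
by rewrite eqr_nat (negbTE pq).
Qed.

(** The two inverses come from the distances of the circles of radius exp(-s) and exp(s) to the unit
    circle. One factor 2 comes from [|B u - B u0|], the other from [cint_bound]. *)
Definition quot_const (s : R) : R := 4 * ((1 - expR (- s))^-1 + (expR s - 1)^-1).

(** A geometric sum telescopes: the sum on the left is the Dirichlet kernel, with terms (u0/u)^l for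
    l from -K to K. On the right, the first term is small for |u| < 1 and the second for |u| > 1. *)
Lemma fourier_kernel (u u0 : C) K : u != 0 -> u0 != 0 ->
  (u - u0) * (\sum_(k < K.*2.+1) u0 ^+ k * u0^-1 ^+ K * (u ^+ K * u^-1 ^+ k)) =
  u ^+ K.+1 * u0^-1 ^+ K - u0 ^+ K.+1 * u^-1 ^+ K.
Proof.
move=> n0 n1.
have E : \sum_(k < K.*2.+1) u0 ^+ k * u0^-1 ^+ K * (u ^+ K * u^-1 ^+ k) =
    u0^-1 ^+ K * u ^+ K * \sum_(k < K.*2.+1) (u0 / u) ^+ k.
  by rewrite mulr_sumr; apply: eq_bigr => k _; rewrite exprMn; ring.
have F := subrX1 (u0 / u) K.*2.+1.
have -> : u - u0 = - (u * (u0 / u - 1)) by rewrite mulrBr mulr1 mulrCA divff // mulr1 opprB.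
rewrite E; move: (\sum_(_ < _) _) F => S F.
transitivity (- (u * (u0^-1 ^+ K * u ^+ K) * ((u0 / u - 1) * S))); first by ring.
rewrite -F.
rewrite -addnn -addnS exprD [(u0 / u) ^+ K]exprMn [(u0 / u) ^+ K.+1]exprMn.
have X (x : C) : x != 0 -> x^-1 ^+ K * x ^+ K = 1.
  by move=> x0; rewrite -exprMn mulVf // expr1n.
have X0 := X _ n0; have X1 := X _ n1.
rewrite !exprS.
transitivity (u * u ^+ K * u0^-1 ^+ K - (u / u) * (u0^-1 ^+ K * u0 ^+ K) * (u^-1 ^+ K * u ^+ K) * (u0 * u0 ^+ K * u^-1 ^+ K)).
  ring.
by rewrite X0 X1 divff // !mul1r.
Qed.

(** On the circle of radius exp(s) the point [u0] is at distance at least [|expR s - 1|], so H is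
    bounded there although no bound is known near [u0]. The sign of s is free, which covers both
    directions. *)
Lemma quot_int_bound (H g : C -> C) u0 s Mg : normc u0 = 1 -> ccont H u0 ->
  normc (B u0) <= M ->
  (forall u, B u - B u0 = H u * (u - u0)) ->
  (forall u, u != u0 -> cdiff B u -> cdiff H u) ->
  (forall u, u != 0 -> cdiff g u) ->
  `|s| < r -> s != 0 -> (forall t, normc (g (cexp s t)) <= Mg) ->
  rcont (fun t => H (cexp 0 t) * g (cexp 0 t)) /\
  normc (circle_int (fun u => H u * g u) 0) <= 2 * (2 * M / `|expR s - 1| * Mg) * (pi *+ 2).
Proof.
move=> nu0 Hc BM0 HE Hd gd sr s0 gM.
have Hc' s' t : `|s'| <= r -> ccont H (cexp s' t).
  move=> s'r; have [->//|/Hd h] := eqVneq (cexp s' t) u0.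
  by apply: cdiff_ccont; apply: h; apply: Bd.
have Qc s' t : `|s'| <= r -> ccont (fun u => H u * g u) (cexp s' t).
  by move=> ?; apply: ccontM; [apply: Hc'|apply/cdiff_ccont/gd/cexp_neq0].
split; first by apply: (@rcont_circle (fun u => H u * g u)) => t; apply: Qc; rewrite normr0 ltW.
rewrite -(@circle_int_const R (fun u => H u * g u) r r0 Qc _ s sr).
  rewrite /circle_int -[X in _ * X]subr0; apply: cint_bound; last 1 first.
  - move=> t _; rewrite ComplexField.Normc.normcM.
    have es1 : 0 < `|expR s - 1| by rewrite normr_gt0 subr_eq0 expR_eq1.
    have le1 : `|expR s - 1| <= normc (cexp s t - u0).
      rewrite -(normc_cexp s t) -nu0 ler_norml; apply/andP; split.
        rewrite lerNl opprB lerBlDr normc_dist -[X in normc X <= _](subrK (cexp s t)).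
        exact: normcD.
      rewrite lerBlDr -[X in normc X <= _](subrK u0); exact: normcD.
    have HH : normc (H (cexp s t)) <= 2 * M / `|expR s - 1|.
      rewrite ler_pdivlMr //; apply: le_trans (ler_wpM2l (normc_ge0 _) le1) _.
      rewrite -ComplexField.Normc.normcM -HE; apply: le_trans (normcB _ _) _.
      have := BM t (ltW sr); lra.
    by apply: ler_pM; rewrite ?normc_ge0.
  - by apply: (@rcont_circle (fun u => H u * g u)) => t; apply: Qc; rewrite ltW.
  - by rewrite ltW // mulrn_wgt0 // pi_gt0.
move=> s' t s'r s'0; apply: cdiffM; last exact/gd/cexp_neq0.
apply: Hd; last exact: Bd.
apply: contra_neq s'0 => E; have := normc_cexp s' t; rewrite E nu0 => /esym/eqP.
by rewrite expR_eq1 => /eqP.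
Qed.

(** Multiplying by the K-th power shifts the frequencies -K..K to 0..2K, so that only natural
    exponents occur. *)
Lemma fourier_approx (s : R) K : 0 < s < r -> exists c : nat -> C, forall t,
  normc (cexp 0 t ^+ K * B (cexp 0 t) - \sum_(k < K.*2.+1) c k * cexp 0 t ^+ k)
   <= quot_const s * M * expR (- s) ^+ K.
Proof.
move=> /andP[s0 sr].
pose P := (pi *+ 2)%:C%C : C.
have p0 : 0 < pi *+ 2 :> R by rewrite mulrn_wgt0 // pi_gt0.
have P0 : P != 0 by rewrite /P eq_complex /= eqxx andbT gt_eqF.
(* This is the Fourier coefficient of B of index k - K. *)
exists (fun k => circle_int (fun u => B u * (u ^+ K * u^-1 ^+ k)) 0 / P) => t0.
set u0 := cexp 0 t0.
have nu0 : normc u0 = 1 by rewrite normc_cexp expR0.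
have u00 : u0 != 0 by apply: cexp_neq0.
have r0' : `|0 : R| <= r by rewrite normr0 ltW.
have [H [HE Hc Hd]] := difference_quotient (Bd t0 r0').
pose g1 u : C := u ^+ K.+1 * u0^-1 ^+ K.
pose g2 u : C := u0 ^+ K.+1 * u^-1 ^+ K.
have g1d u : u != 0 -> cdiff g1 u.
  by move=> ?; apply: cdiffM; [apply/cdiffX/cdiff_id|apply: cdiff_cst].
have g2d u : u != 0 -> cdiff g2 u.
  move=> ?; apply: cdiffM; first exact: cdiff_cst.
  by apply: (@cdiffX _ (fun u => u^-1)); apply: (@cdiffV _ id) => //; apply: cdiff_id.
have sr1 : `|- s| < r by rewrite normrN gtr0_norm.
have sr2 : `|s| < r by rewrite gtr0_norm.
have s1 : - s != 0 by rewrite oppr_eq0 gt_eqF.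
have s2 : s != 0 by rewrite gt_eqF.
have nV : normc u0^-1 = 1 by rewrite ComplexField.Normc.normcV nu0 invr1.
have g1M t : normc (g1 (cexp (- s) t)) <= expR (- s) ^+ K.
  rewrite /g1 ComplexField.Normc.normcM !normcX nV expr1n mulr1 normc_cexp exprSr.
  by rewrite ler_piMr ?exprn_ge0 ?expR_ge0 // expR_le1 oppr_le0 ltW.
have g2M t : normc (g2 (cexp s t)) <= expR (- s) ^+ K.
  rewrite /g2 ComplexField.Normc.normcM !normcX nu0 expr1n mul1r.
  by rewrite ComplexField.Normc.normcV normc_cexp expRN.
have [c1 b1] := quot_int_bound nu0 Hc (BM t0 r0') HE Hd g1d sr1 s1 g1M.
have [c2 b2] := quot_int_bound nu0 Hc (BM t0 r0') HE Hd g2d sr2 s2 g2M.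
pose phi k t : C := cexp 0 t ^+ K * (cexp 0 t)^-1 ^+ k.
have phic k : rcont (phi k).
  by apply: (@rcont_circle (fun u => u ^+ K * u^-1 ^+ k)) => t; apply/cdiff_ccont/cdiff_monomial/cexp_neq0.
have Bphic k : rcont (fun t => B (cexp 0 t) * phi k t).
  apply: (@rcont_circle (fun u => B u * (u ^+ K * u^-1 ^+ k))) => t; apply/cdiff_ccont/cdiffM; first exact: Bd.
  exact/cdiff_monomial/cexp_neq0.
pose w k : C := u0 ^+ k * u0^-1 ^+ K.
(* The Dirichlet kernel has mean 1 ([sumP]), so the error is the mean of [B u - B u0] against it.
   Writing this difference as [H u * (u - u0)] lets the factor u - u0 collapse the kernel. *)
have key : \sum_(k < K.*2.+1) w k * circle_int (fun u => B u * (u ^+ K * u^-1 ^+ k)) 0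
    - B u0 * P = circle_int (fun u => H u * g1 u) 0 - circle_int (fun u => H u * g2 u) 0.
  have sumP : \sum_(k < K.*2.+1) w k * circle_int (fun u => u ^+ K * u^-1 ^+ k) 0 = P.
    have lt : (K < K.*2.+1)%N by rewrite ltnS -addnn leq_addr.
    rewrite (bigD1 (Ordinal lt)) //= big1 => [|k kK]; last first.
      rewrite circle_int_monomial ifF ?mulr0 //; apply/negbTE.
      by apply: contra kK => /eqP kK; apply/eqP/val_inj.
    by rewrite circle_int_monomial eqxx addr0 /w -exprMn divff // expr1n mul1r.
  rewrite -sumP mulr_sumr -sumrB.
  transitivity (cint (fun t => \sum_(k < K.*2.+1) w k * (B (cexp 0 t) * phi k t + - B u0 * phi k t)) 0 (pi *+ 2)).
    have [|_ ->] := @cint_sum R _ (index_enum 'I_K.*2.+1) xpredT (fun k t => w k * (B (cexp 0 t) * phi k t + - B u0 * phi k t)) 0 (pi *+ 2).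
      by move=> k; apply: rcontZ; apply: rcontD => //; apply: rcontZ.
    apply: eq_bigr => k _; rewrite cintZ; last by apply: rcontD => //; apply: rcontZ.
    rewrite cintD //; last exact: rcontZ.
    by rewrite cintZ // /circle_int /phi; ring.
  transitivity (cint (fun t => H (cexp 0 t) * g1 (cexp 0 t) + -1 * (H (cexp 0 t) * g2 (cexp 0 t))) 0 (pi *+ 2)).
    congr cint; apply/funext => t.
    have := fourier_kernel K (cexp_neq0 0 t) u00; rewrite -/(g1 _) -/(g2 _) => FK.
    rewrite mulN1r -mulrBr -FK mulrA -HE mulr_sumr; apply: eq_bigr => k _.
    by rewrite /w /phi; ring.
  by rewrite cintD ?cintZ ?mulN1r //; apply: rcontZ.
have -> : u0 ^+ K * B u0 - \sum_(k < K.*2.+1) circle_int (fun u => B u * (u ^+ K * u^-1 ^+ k)) 0 / P * u0 ^+ k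
  = - (u0 ^+ K / P * (circle_int (fun u => H u * g1 u) 0 - circle_int (fun u => H u * g2 u) 0)).
  have X : u0 ^+ K * u0^-1 ^+ K = 1 by rewrite -exprMn divff // expr1n.
  rewrite -key mulrBr opprB; congr (_ - _).
    by rewrite [B u0 * P]mulrC mulrA divfK.
  rewrite mulr_sumr; apply: eq_bigr => k _; rewrite /w.
  transitivity (circle_int (fun u => B u * (u ^+ K * u^-1 ^+ k)) 0 / P * u0 ^+ k * (u0 ^+ K * u0^-1 ^+ K)); first by rewrite X mulr1.
  ring.
rewrite normcN !ComplexField.Normc.normcM normcX nu0 expr1n mul1r ComplexField.Normc.normcV.
rewrite /P normc_real gtr0_norm // mulrC ler_pdivrMr //.
apply: le_trans (normcB _ _) _; apply: le_trans (lerD b1 b2) _.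
have e1 : `|expR (- s) - 1| = 1 - expR (- s).
  by rewrite distrC ger0_norm // subr_ge0 expR_le1 oppr_le0 ltW.
have e2 : `|expR s - 1| = expR s - 1.
  by rewrite ger0_norm // subr_ge0 -expR0 ler_expR ltW.
rewrite e1 e2 /quot_const le_eqVlt; apply/orP; left; apply/eqP.
by move: (pi *+ 2) (expR (- s) ^+ K) => x y; ring.
Qed.
End FourierApprox.

(** * Discrete Fourier projection and Chebyshev kernels *)

Section DiscreteProjection.
Variable R : realType.
Local Notation C := R[i].
Local Notation normc := (@ComplexField.Normc.normc R).
Local Notation cis := (@cexp R 0).

Lemma cisD x y : cis (x + y) = cis x * cis y.
Proof. by rewrite -cexpD addr0. Qed.

Lemma cisX x k : cis x ^+ k = cis (x * k%:R).
Proof. by rewrite cexpX mul0rn mulr_natr. Qed.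

Lemma cisN x : cis (- x) = (cis x)^-1.
Proof.
have x0 := cexp_neq0 0 x.
by apply: (mulfI x0); rewrite divff // -cisD subrr cexp0.
Qed.

Lemma Re_cis x : complex.Re (cis x) = cos x.
Proof. by rewrite /cexp expR0 /= mul1r. Qed.

Lemma normc_cis x : normc (cis x) = 1.
Proof. by rewrite normc_cexp expR0. Qed.

Lemma cis2pi : cis (pi *+ 2) = 1.
Proof. by rewrite cexp2pi cexp0. Qed.

Definition node M j : R := pi *+ 2 / M%:R * j%:R.

(** If it were 1, half the angle would have sine zero, yet that half lies strictly between 0 and pi
    in absolute value. *)
Lemma cis_node_neq1 M k l : (0 < M)%N -> (k < M)%N -> (l < M)%N -> k != l ->
  cis (pi *+ 2 / M%:R * (l%:R - k%:R)) != 1.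
Proof.
move=> M0 kM lM kl; apply/eqP => E.
set y : R := pi / M%:R * (l%:R - k%:R).
have xy : pi *+ 2 / M%:R * (l%:R - k%:R) = y *+ 2.
  by rewrite /y !mulr2n !mulrDl.
have : cos (y *+ 2) = 1 by rewrite -xy -Re_cis E.
rewrite cos_mulr2n => E2.
have s0 : sin y = 0.
  by apply/eqP; rewrite -sqrf_eq0 sin2cos2; apply/eqP; lra.
have M0' : 0 < M%:R :> R by rewrite ltr0n.
have p0 := pi_gt0 R.
have pos a b : (a < b)%N -> (b < M)%N -> 0 < sin (pi / M%:R * (b%:R - a%:R) : R).
  move=> ab bM; apply: sin_gt0_pi.
  have h1 : 0 < b%:R - a%:R :> R by rewrite subr_gt0 ltr_nat.
  rewrite mulr_gt0 ?divr_gt0 //= mulrAC ltr_pdivrMr // ltr_pM2l //.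
  have : b%:R < M%:R :> R by rewrite ltr_nat.
  have : 0 <= a%:R :> R by rewrite ler0n.
  lra.
case: (ltngtP k l) kl => // kl _.
  by have := pos _ _ kl lM; rewrite -/y s0 ltxx.
have := pos _ _ kl kM; have -> : pi / M%:R * (k%:R - l%:R) = - y by rewrite /y; ring.
by rewrite sinN s0 oppr0 ltxx.
Qed.

Lemma discrete_orth M k l : (0 < M)%N -> (k < M)%N -> (l < M)%N ->
  \sum_(j < M) cis (node M j) ^+ l * (cis (node M j))^-1 ^+ k = if k == l then M%:R else 0.
Proof.
move=> M0 kM lM; case: eqP => [->|/eqP kl].
  under eq_bigr do rewrite -exprMn divff ?cexp_neq0 // expr1n.
  by rewrite sumr_const card_ord.
set w := cis (pi *+ 2 / M%:R * (l%:R - k%:R)).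
have M0' : M%:R != 0 :> R by rewrite pnatr_eq0 -lt0n.
have wM : w ^+ M = 1.
  rewrite /w cisX.
  have -> : pi *+ 2 / M%:R * (l%:R - k%:R) * M%:R = pi *+ 2 * l%:R - pi *+ 2 * k%:R :> R.
    by move: (pi *+ 2 : R) => p; field.
  by rewrite cisD cisN -!cisX cis2pi !expr1n invr1 mulr1.
have := subrX1 w M; rewrite wM subrr => /esym/eqP; rewrite mulf_eq0 subr_eq0.
rewrite (negbTE (cis_node_neq1 M0 kM lM kl)) /= => /eqP S0; rewrite -[RHS]S0.
apply: eq_bigr => j _; rewrite -cisN !cisX -cisD; congr cis; rewrite /node.
by move: (pi *+ 2 / M%:R : R) => p; ring.
Qed.

(** Lebesgue's inequality: orthogonality at the nodes makes the projection fix the polynomial, so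
    only the norm of the projection multiplies the error. The triangle inequality bounds that norm
    by M, which exponential decay can absorb. *)
Lemma discrete_projection M (W : R -> C) (c : nat -> C) eta t : (0 < M)%N ->
  (forall t, normc (W t - \sum_(k < M) c k * cis t ^+ k) <= eta) ->
  normc (W t - M%:R^-1 * \sum_(j < M) W (node M j) * \sum_(k < M) (cis t / cis (node M j)) ^+ k)
    <= (1 + M%:R) * eta.
Proof.
move=> M0 HW.
have M0' : M%:R != 0 :> C by rewrite pnatr_eq0 -lt0n.
pose p t := \sum_(k < M) c k * cis t ^+ k.
have pE : p t = M%:R^-1 * \sum_(j < M) p (node M j) * \sum_(k < M) (cis t / cis (node M j)) ^+ k.
  have -> : \sum_(j < M) p (node M j) * (\sum_(k < M) (cis t / cis (node M j)) ^+ k)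
      = \sum_(l < M) \sum_(k < M) c l * cis t ^+ k * \sum_(j < M) cis (node M j) ^+ l * (cis (node M j))^-1 ^+ k.
    under eq_bigr do rewrite /p mulr_suml.
    rewrite exchange_big; apply: eq_bigr => l _.
    under eq_bigr do rewrite mulr_sumr.
    rewrite exchange_big; apply: eq_bigr => k _; rewrite mulr_sumr.
    by apply: eq_bigr => j _; rewrite exprMn; ring.
  rewrite mulr_sumr; apply: eq_bigr => l _.
  rewrite (bigD1 l) //= discrete_orth // eqxx big1 => [|k kl].
    by rewrite addr0; field.
  by rewrite discrete_orth // ifF ?mulr0 //; apply/negbTE.
set Z := M%:R^-1 * _.
have -> : W t - Z = (W t - p t) - (Z - p t) by ring.
apply: le_trans (normcB _ _) _; rewrite mulrDl mul1r; apply: lerD; first exact: HW.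
rewrite /Z pE -mulrBr -sumrB ComplexField.Normc.normcM.
have nM : normc M%:R = M%:R.
  by rewrite -(rmorph_nat (real_complex R)) normc_real ger0_norm.
rewrite ComplexField.Normc.normcV nM mulrC ler_pdivrMr ?ltr0n //.
apply: le_trans (normc_sum _ _ _) _.
apply: (@le_trans _ _ (\sum_(j < M) eta * M%:R)); last first.
  rewrite sumr_const card_ord -mulr_natr le_eqVlt; apply/orP; left; apply/eqP; ring.
apply: ler_sum => j _; rewrite -mulrBl ComplexField.Normc.normcM.
apply: (ler_pM (normc_ge0 _) (normc_ge0 _) (HW _)).
apply: le_trans (normc_sum _ _ _) _.
apply: (@le_trans _ _ (\sum_(k < M) 1)); last by rewrite sumr_const card_ord.
apply: ler_sum => k _; rewrite normcX ComplexField.Normc.normcM.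
by rewrite ComplexField.Normc.normcV !normc_cis invr1 mulr1 expr1n.
Qed.

Lemma cos_cheb k (t : R) : cheb k (cos t) = cos (k%:R * t).
Proof.
elim/ltn_ind: k => -[_|[_|k IH]]; first by rewrite mul0r cos0.
  by rewrite mul1r.
have -> : cheb k.+2 (cos t) = 2 * cos t * cheb k.+1 (cos t) - cheb k (cos t) by [].
rewrite !IH //.
have -> : k.+2%:R * t = k.+1%:R * t + t by rewrite -natr1; ring.
have -> : k%:R * t = k.+1%:R * t - t by rewrite -natr1; ring.
by rewrite cosB cosD; ring.
Qed.

Lemma cheb_le1 k (y : R) : -1 <= y <= 1 -> `|cheb k y| <= 1.
Proof. by move=> y1; rewrite -(@acosK R y) ?in_itv // cos_cheb cos_max. Qed.

(** Natural subtraction truncates at zero, so one summand vanishes and the other is |k - K|. *)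
Definition absdist (k K : nat) : nat := (k - K + (K - k))%N.

Lemma cos_absdist k K (t : R) : cos ((k%:R - K%:R) * t) = cheb (absdist k K) (cos t).
Proof.
rewrite cos_cheb /absdist; have [kK|/ltnW kK] := leqP k K.
  have /eqP -> : (k - K == 0)%N by rewrite subn_eq0.
  by rewrite add0n natrB // -cosN; congr cos; ring.
have /eqP -> : (K - k == 0)%N by rewrite subn_eq0.
by rewrite addn0 natrB.
Qed.

Definition cheb_node K j : R := cos (node K.*2.+1 j).
(** The even part in t of the Dirichlet kernel centred at the j-th angle, written in y = cos t. Its
    2K+1 terms match the frequencies k - K. *)
Definition cheb_kernel K j (y : R) : R :=
  K.*2.+1%:R^-1 * \sum_(k < K.*2.+1) cheb (absdist k K) (cheb_node K j) * cheb (absdist k K) y.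

Lemma cheb_node_in K j : -1 <= cheb_node K j <= 1.
Proof. by rewrite /cheb_node cos_geN1 cos_le1. Qed.

Lemma cheb_kernel_sum K (y : R) : -1 <= y <= 1 ->
  \sum_(j < K.*2.+1) `|cheb_kernel K j y| <= K.*2.+1%:R.
Proof.
move=> y1; apply: (@le_trans _ _ (\sum_(j < K.*2.+1) 1)); last by rewrite sumr_const card_ord.
apply: ler_sum => j _; rewrite /cheb_kernel normrM normfV (@ger0_norm _ K.*2.+1%:R) //.
rewrite mulrC ler_pdivrMr ?ltr0n // mul1r.
apply: le_trans (ler_norm_sum _ _ _) _.
apply: (@le_trans _ _ (\sum_(k < K.*2.+1) 1)); last by rewrite sumr_const card_ord.
apply: ler_sum => k _; rewrite normrM -[leRHS]mulr1.
by apply: ler_pM => //; apply: cheb_le1 => //; apply: cheb_node_in.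
Qed.

(** Frequencies of opposite sign give the same Chebyshev polynomial. Grouping them leaves K+1 terms,
    the base of the final count. *)
Lemma cheb_kernelE K j : exists lam : 'I_K.+1 -> R, forall y,
  cheb_kernel K j y = \sum_(q < K.+1) lam q * cheb q y.
Proof.
exists (fun q => K.*2.+1%:R^-1 * \sum_(k < K.*2.+1 | inord (absdist k K) == q) cheb q (cheb_node K j)).
move=> y; rewrite /cheb_kernel (partition_big (fun k : 'I_K.*2.+1 => inord (absdist k K) : 'I_K.+1) xpredT) //=.
rewrite mulr_sumr; apply: eq_bigr => q _; rewrite -mulrA mulr_suml; congr (_ * _).
apply: eq_bigr => k /eqP <-; rewrite inordK // /absdist ltnS.
have kK : (k <= K + K)%N by rewrite addnn -ltnS.
have [h|/ltnW h] := leqP k K.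
  have /eqP -> : (k - K == 0)%N by rewrite subn_eq0.
  by rewrite add0n leq_subr.
have /eqP -> : (K - k == 0)%N by rewrite subn_eq0.
by rewrite addn0 leq_subLR.
Qed.

Lemma cheb_kernel_approx K (g : R -> R) (c : nat -> C) eta :
  (forall t, normc (cis t ^+ K * (g (cos t))%:C%C - \sum_(k < K.*2.+1) c k * cis t ^+ k) <= eta) ->
  forall y, -1 <= y <= 1 ->
  `|g y - \sum_(j < K.*2.+1) cheb_kernel K j y * g (cheb_node K j)| <= (1 + K.*2.+1%:R) * eta.
Proof.
move=> H y y1; rewrite -(@acosK R y) ?in_itv //; move: (acos y) => t {y y1}.
set M := K.*2.+1.
(* Dividing by [cis s ^+ K], of modulus 1, undoes the frequency shift. As g is real, taking real
   parts turns the exponentials into cosines. *)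
have real_part s : `|g (cos s) - M%:R^-1 * \sum_(j < M) g (cheb_node K j) *
     \sum_(k < M) cos ((k%:R - K%:R) * (s - node M j))| <= (1 + M%:R) * eta.
  have := @discrete_projection M _ c eta s isT H.
  set X := normc _; suff : `|g (cos s) - M%:R^-1 * \sum_(j < M) g (cheb_node K j) *
     \sum_(k < M) cos ((k%:R - K%:R) * (s - node M j))| <= X by apply: le_trans.
  have -> : X = normc ((cis s)^-1 ^+ K) * X.
    by rewrite normcX ComplexField.Normc.normcV normc_cis invr1 expr1n mul1r.
  rewrite /X -ComplexField.Normc.normcM; apply: le_trans (Re_le_normc _).
  rewrite le_eqVlt; apply/orP; left; apply/eqP; congr (`| _ |).
  rewrite mulrBr mulrA -exprMn mulVf ?cexp_neq0 // expr1n mul1r raddfB /=; congr (_ - _).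
  have -> : (cis s)^-1 ^+ K * (M%:R^-1 * \sum_(j < M) cis (node M j) ^+ K * (g (cos (node M j)))%:C%C
      * \sum_(k < M) (cis s / cis (node M j)) ^+ k) =
      ((M%:R^-1)%:C)%C * \sum_(j < M) (g (cheb_node K j))%:C%C * \sum_(k < M) cis ((k%:R - K%:R) * (s - node M j)).
    have -> : ((M%:R^-1)%:C)%C = M%:R^-1 :> C by rewrite fmorphV rmorph_nat.
    rewrite mulrCA; congr (_ * _); rewrite mulr_sumr; apply: eq_bigr => j _.
    rewrite !mulr_sumr; apply: eq_bigr => k _.
    have -> : (k%:R - K%:R) * (s - node M j) = - (s * K%:R) + (node M j * K%:R) + (s * k%:R) - node M j * k%:R by ring.
    rewrite !cisD !cisN -!cisX exprMn !exprVn /cheb_node -/M; ring.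
  have ReM (a : R) (z : C) : complex.Re ((a%:C)%C * z) = a * complex.Re z.
    by case: z => ? ? /=; ring.
  have ReS (F : 'I_M -> C) : complex.Re (\sum_(j < M) F j) = \sum_(j < M) complex.Re (F j).
    exact: raddf_sum.
  rewrite ReM ReS; congr (_ * _); apply: eq_bigr => j _.
  by rewrite ReM ReS; congr (_ * _); apply: eq_bigr => k _; rewrite -Re_cis.
(* Averaging over [t] and [-t] removes the sine products. *)
have H1 := real_part t; have := real_part (- t); rewrite cosN => H2.
set S1 := M%:R^-1 * _ in H1; set S2 := M%:R^-1 * _ in H2.
have -> : \sum_(j < M) cheb_kernel K j (cos t) * g (cheb_node K j) = 2^-1 * (S1 + S2).
  rewrite /S1 /S2 -mulrDr -big_split /= mulrCA !mulr_sumr; apply: eq_bigr => j _.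
  rewrite -mulrDr -big_split /= /cheb_kernel -/M -!mulrA; congr (_ * _).
  rewrite [LHS]mulrC mulrCA; congr (_ * _); rewrite mulr_sumr; apply: eq_bigr => k _.
  have -> : (k%:R - K%:R) * (t - node M j) = (k%:R - K%:R) * t - (k%:R - K%:R) * node M j by ring.
  have -> : (k%:R - K%:R) * (- t - node M j) = - ((k%:R - K%:R) * t + (k%:R - K%:R) * node M j) by ring.
  by rewrite cosN cosB cosD -/(cheb_node K j) !cos_absdist -/(cheb_node K j); field.
have -> : g (cos t) - 2^-1 * (S1 + S2) = 2^-1 * ((g (cos t) - S1) + (g (cos t) - S2)) by field.
rewrite normrM ger0_norm ?invr_ge0 //.
have := ler_normD (g (cos t) - S1) (g (cos t) - S2); lra.
Qed.

End DiscreteProjection.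

(** * Interpolation in several variables *)

Section Tensor.
Variable R : realType.
Variable K : nat.
Local Notation ker j := (@cheb_kernel R K j).
Local Notation nd j := (@cheb_node R K j).
Local Notation M := K.*2.+1.
Local Notation L := (M%:R : R).

Definition upd N (v : 'rV[R]_N) (i : 'I_N) (a : R) : 'rV[R]_N :=
  \row_k (if k == i then a else v 0 k).

Fixpoint interp N (s : seq 'I_N) (psi : 'rV[R]_N -> R) (v : 'rV[R]_N) : R :=
  if s is i :: s' then \sum_(j < M) ker j (v 0 i) * interp s' psi (upd v i (nd j))
  else psi v.

Lemma upd_cube N (v : 'rV[R]_N) i a : in_cube v -> -1 <= a <= 1 -> in_cube (upd v i a).
Proof. by move=> vc ac k; rewrite mxE; case: eqP. Qed.

Lemma upd_upd N (v : 'rV[R]_N) i a b : upd (upd v i a) i b = upd v i b.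
Proof. by apply/rowP => k; rewrite !mxE; case: eqP. Qed.

Lemma updC N (v : 'rV[R]_N) i k a b : i != k -> upd (upd v i a) k b = upd (upd v k b) i a.
Proof.
move=> ik; apply/rowP => l; rewrite !mxE.
by case: eqP => // ->; rewrite eq_sym (negbTE ik).
Qed.

Lemma kernel_step N (i : 'I_N) (F : 'rV[R]_N -> R) e v :
  (forall v, in_cube v -> `|F v| <= e) -> in_cube v ->
  `|\sum_(j < M) ker j (v 0 i) * F (upd v i (nd j))| <= L * e.
Proof.
move=> Fe vc; apply: le_trans (ler_norm_sum _ _ _) _.
apply: (@le_trans _ _ (\sum_(j < M) `|ker j (v 0 i)| * e)).
  apply: ler_sum => j _; rewrite normrM ler_wpM2l //; apply: Fe.
  by apply: upd_cube => //; apply: cheb_node_in.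
rewrite -mulr_suml ler_wpM2r ?cheb_kernel_sum //.
exact: le_trans (normr_ge0 _) (Fe v vc).
Qed.

Lemma interp_bound N (s : seq 'I_N) (psi1 psi2 : 'rV[R]_N -> R) e :
  (forall v, in_cube v -> `|psi1 v - psi2 v| <= e) ->
  forall v, in_cube v -> `|interp s psi1 v - interp s psi2 v| <= L ^+ size s * e.
Proof.
move=> H; elim: s => [|i s IH] v vc /=; first by rewrite mul1r; apply: H.
rewrite -sumrB; under eq_bigr do rewrite -mulrBr.
rewrite exprS -mulrA; exact: (kernel_step i IH).
Qed.

(** The error telescopes: the first coordinate contributes its own error, and its kernel, of norm at
    most L, acts on the error of the remaining ones. *)
Lemma interp_approx N (s : seq 'I_N) (psi : 'rV[R]_N -> R) eta : 0 <= eta ->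
  (forall i v, in_cube v ->
     `|psi v - \sum_(j < M) ker j (v 0 i) * psi (upd v i (nd j))| <= eta) ->
  forall v, in_cube v -> `|psi v - interp s psi v| <= (size s)%:R * L ^+ size s * eta.
Proof.
move=> eta0 H; elim: s => [|i s IH] v vc /=; first by rewrite subrr normr0 !mul0r.
have L1 : 1 <= L by rewrite ler1n.
have -> : psi v - \sum_(j < M) ker j (v 0 i) * interp s psi (upd v i (nd j)) =
  (psi v - \sum_(j < M) ker j (v 0 i) * psi (upd v i (nd j))) +
  \sum_(j < M) ker j (v 0 i) * (psi (upd v i (nd j)) - interp s psi (upd v i (nd j))).
  have -> : \sum_(j < M) ker j (v 0 i) * (psi (upd v i (nd j)) - interp s psi (upd v i (nd j)))
    = \sum_(j < M) ker j (v 0 i) * psi (upd v i (nd j)) -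
      \sum_(j < M) ker j (v 0 i) * interp s psi (upd v i (nd j)).
    by rewrite -sumrB; apply: eq_bigr => j _; rewrite mulrBr.
  by rewrite addrA subrK.
apply: le_trans (ler_normD _ _) _.
have h2 := @kernel_step _ i (fun v => psi v - interp s psi v) _ v IH vc.
apply: le_trans (lerD (H i v vc) h2) _.
have : eta <= L ^+ (size s).+1 * eta by rewrite ler_peMl // exprn_ege1.
rewrite -natr1 exprS; nra.
Qed.

(** [Z] carries the variables left alone and [X] a class of functions of them, so that one induction
    serves both blocks. Zero degrees outside s leave the next coordinate free for its own factor;
    the invariance clause will make the coefficients independent of v. *)
Lemma interp_rank N (Z : Type) (X : (Z -> R) -> Prop) (psi : 'rV[R]_N -> Z -> R)
    (s : seq 'I_N) :
  (forall (a : 'I_M -> R) (F : 'I_M -> Z -> R), (forall j, X (F j)) ->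
     X (fun z => \sum_(j < M) a j * F j z)) ->
  (forall v, X (psi v)) -> uniq s ->
  exists (I : finType) (c : I -> 'rV[R]_N -> Z -> R) (e : I -> {ffun 'I_N -> nat}),
    [/\ #|I| = (K.+1 ^ size s)%N,
        forall v z, interp s (psi^~ z) v =
          \sum_(q : I) c q v z * \prod_(i < N) cheb (e q i) (v 0 i),
        forall q v, X (c q v),
        forall q v i a, i \in s -> c q (upd v i a) = c q v &
        forall q i, i \notin s -> e q i = 0%N].
Proof.
move=> Xlin Xpsi; elim: s => [|i s IH] /=.
  move=> _; exists unit, (fun _ => psi), (fun _ => [ffun=> 0%N]).
  split => //; first by rewrite card_unit.
    move=> v z; rewrite (big_pred1 tt) => [|[]//].
    by rewrite big1 ?mulr1 // => k _; rewrite ffunE.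
  by move=> _ k _; rewrite ffunE.
move=> /andP[iNs us]; have [I [c [e [cI cE cX cs es]]]] := IH us.
have [lam lamE] := choice (fun j : 'I_M => @cheb_kernelE R K j).
exists ('I_K.+1 * I)%type,
  (fun kq v z => \sum_(j < M) lam j kq.1 * c kq.2 (upd v i (nd j)) z),
  (fun kq => [ffun k => if k == i then nat_of_ord kq.1 else e kq.2 k]).
split.
- by rewrite card_prod card_ord cI expnS.
- move=> v z.
  pose b q := \prod_(k < N | k != i) cheb (e q k) (v 0 k).
  have bE q a : \prod_(k < N) cheb (e q k) (upd v i a 0 k) = b q.
    rewrite (bigD1 i) //= es // mul1r; apply: eq_bigr => k ki.
    by rewrite mxE (negbTE ki).
  have bE' (k : 'I_K.+1) q :
    \prod_(l < N) cheb ([ffun l => if l == i then nat_of_ord k else e q l] l) (v 0 l)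
      = cheb k (v 0 i) * b q.
    rewrite (bigD1 i) //= ffunE eqxx; congr (_ * _); apply: eq_bigr => l li.
    by rewrite ffunE (negbTE li).
  transitivity (\sum_(k < K.+1) \sum_(q : I)
      (\sum_(j < M) lam j k * c q (upd v i (nd j)) z) * (cheb k (v 0 i) * b q)); last first.
    by rewrite pair_bigA; apply: eq_bigr => -[k q] _; rewrite /= bE'.
  have cE' j : interp s (psi^~ z) (upd v i (nd j)) = \sum_(q : I) c q (upd v i (nd j)) z * b q.
    by rewrite cE; apply: eq_bigr => q _; rewrite bE.
  under eq_bigr => j _.
    rewrite cE' lamE mulr_suml; under eq_bigr do rewrite mulr_sumr.
    over.
  rewrite exchange_big; apply: eq_bigr => k _ /=.
  rewrite exchange_big; apply: eq_bigr => q _ /=.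
  by rewrite mulr_suml; apply: eq_bigr => j _; ring.
- by move=> [k q] v; apply: Xlin => j; apply: cX.
- move=> [k q] v i' a /=; rewrite inE => i's; apply/funext => z; apply: eq_bigr => j _.
  have [->|ii'] := eqVneq i' i; first by rewrite upd_upd.
  rewrite updC // cs //; by move: i's; rewrite (negbTE ii').
- move=> [k q] i'; rewrite inE negb_or => /andP[ii' i's].
  by rewrite ffunE /= (negbTE ii') es.
Qed.

Lemma upd_invariant N (T : Type) (h : 'rV[R]_N -> T) :
  (forall v i a, h (upd v i a) = h v) -> forall v v', h v = h v'.
Proof.
move=> H v v'.
pose mix (s : seq 'I_N) : 'rV[R]_N := \row_k (if k \in s then v' 0 k else v 0 k).
have mixE s : h (mix s) = h v.
  elim: s => [|i s IH].
    by congr h; apply/rowP => k; rewrite mxE.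
  rewrite -IH -(H (mix s) i (v' 0 i)); congr h; apply/rowP => k.
  by rewrite !mxE inE; case: eqP => [->|].
rewrite -(mixE (enum 'I_N)); congr h; apply/rowP => k.
by rewrite mxE mem_enum.
Qed.

Lemma interp_full N (Z : Type) (X : (Z -> R) -> Prop) (psi : 'rV[R]_N -> Z -> R) :
  (forall (a : 'I_M -> R) (F : 'I_M -> Z -> R), (forall j, X (F j)) ->
     X (fun z => \sum_(j < M) a j * F j z)) ->
  (forall v, X (psi v)) ->
  exists (I : finType) (c : I -> Z -> R) (e : I -> {ffun 'I_N -> nat}),
    [/\ #|I| = (K.+1 ^ N)%N,
        forall v z, interp (enum 'I_N) (psi^~ z) v =
          \sum_(q : I) c q z * \prod_(i < N) cheb (e q i) (v 0 i) &
        forall q, X (c q)].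
Proof.
move=> Xlin Xpsi.
have [I [c [e [cI cE cX cs _]]]] := interp_rank Xlin Xpsi (enum_uniq 'I_N).
exists I, (fun q => c q 0), e; split => //.
  by rewrite cI size_enum_ord.
move=> v z; rewrite cE; apply: eq_bigr => q _.
rewrite (_ : c q v = c q 0) //.
by apply: (@upd_invariant _ _ (c q)) => w i a; apply: cs; rewrite mem_enum.
Qed.

Lemma cheb_poly_sum n (I : finType) (a : I -> R) (F : I -> 'rV[R]_n -> R) :
  (forall j, cheb_poly (F j)) -> cheb_poly (fun z => \sum_(j : I) a j * F j z).
Proof.
move=> /choice [s sE].
exists [seq (a j * p.1, p.2) | j <- index_enum I, p <- s j] => x.
rewrite big_allpairs_dep; apply: eq_bigr => j _.
by rewrite sE mulr_sumr; apply: eq_bigr => p _; rewrite mulrA.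
Qed.

Lemma cheb_poly_prod n (e : {ffun 'I_n -> nat}) :
  cheb_poly (fun x : 'rV[R]_n => \prod_(i < n) cheb (e i) (x 0 i)).
Proof. by exists [:: (1, e)] => x; rewrite big_seq1 mul1r. Qed.

(** Interpolating in x first makes every [f1 w] a Chebyshev sum in x, of any length. Interpolating
    that in w takes finite linear combinations of such sums as coefficients, so each term is a
    polynomial in x times a product in w, and only degrees in w are counted. *)
Lemma separated_approx n m (f : 'rV[R]_n -> 'rV[R]_m -> R) eta : 0 <= eta ->
  (forall i x w, in_cube x -> in_cube w ->
     `|f x w - \sum_(j < M) ker j (x 0 i) * f (upd x i (nd j)) w| <= eta) ->
  (forall i x w, in_cube x -> in_cube w ->
     `|f x w - \sum_(j < M) ker j (w 0 i) * f x (upd w i (nd j))| <= eta) ->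
  exists (phi : 'rV[R]_n -> 'rV[R]_(K.+1 ^ m)) (a : 'rV[R]_m -> 'cV[R]_(K.+1 ^ m)),
    [/\ cheb_row phi, cheb_col a &
        forall x w, in_cube x -> in_cube w ->
          `|f x w - (phi x *m a w) 0 0| <= (n + m)%:R * L ^+ (n + m) * eta].
Proof.
move=> eta0 Hx Hw.
pose f1 w x := interp (enum 'I_n) (fun x => f x w) x.
have f1P w : cheb_poly (f1 w).
  have [I [c [e [_ cE _]]]] := @interp_full n unit (fun=> True) (fun x _ => f x w)
    (fun _ _ _ => Logic.I) (fun _ => Logic.I).
  have -> : f1 w = fun x => \sum_(q : I) c q tt * \prod_(i < n) cheb (e q i) (x 0 i).
    by apply/funext => x; apply: (cE x tt).
  by apply: cheb_poly_sum => q; apply: cheb_poly_prod.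
have [I [c [e [cI cE cP]]]] := @interp_full m _ (@cheb_poly R n) f1
  (fun a F => @cheb_poly_sum n _ a F) f1P.
(* Replacing the dimension by [#|I|] lets [enum_val] index rows and columns by the terms. *)
move: (K.+1 ^ m)%N cI => h cI; case: h / cI.
exists (fun x => \row_q c (@enum_val I I q) x),
  (fun w => \col_q \prod_(i < m) cheb (e (@enum_val I I q) i) (w 0 i)).
split.
- by move=> q; under eq_fun do rewrite mxE; apply: cP.
- by move=> q; under eq_fun do rewrite mxE; apply: cheb_poly_prod.
move=> x w xc wc.
have -> : ((\row_q c (@enum_val I I q) x) *m
     (\col_q \prod_(i < m) cheb (e (@enum_val I I q) i) (w 0 i))) 0 0 = interp (enum 'I_m) (f1^~ x) w.
  rewrite cE mxE [RHS](reindex _ (onW_bij _ (enum_val_bij I))) /=.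
  by apply: eq_bigr => q _; rewrite !mxE.
have -> : f x w - interp (enum 'I_m) (f1^~ x) w =
   (f x w - interp (enum 'I_m) (f x) w)
   + (interp (enum 'I_m) (f x) w - interp (enum 'I_m) (f1^~ x) w) by ring.
apply: le_trans (ler_normD _ _) _.
have h1 := interp_approx (enum 'I_m) eta0 (fun i v vc => Hw i x v xc vc) wc.
have h2 : `|interp (enum 'I_m) (f x) w - interp (enum 'I_m) (f1^~ x) w| <=
    L ^+ size (enum 'I_m) * (n%:R * L ^+ n * eta).
  apply: interp_bound wc => v vc.
  have := interp_approx (enum 'I_n) eta0 (fun i y yc => Hx i y v yc vc) xc.
  by rewrite size_enum_ord.
apply: le_trans (lerD h1 h2) _; rewrite size_enum_ord natrD exprD.
have Ln : 1 <= L ^+ n by rewrite exprn_ege1 // ler1n.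
have : m%:R * L ^+ m * eta <= m%:R * L ^+ m * eta * L ^+ n.
  by rewrite ler_peMr // !mulr_ge0 ?exprn_ge0.
lra.
Qed.

End Tensor.

(** * Slices of the analytic function *)

Section Box.
Variable R : realType.
Local Notation C := R[i].
Local Notation normc := (@ComplexField.Normc.normc R).

Definition cbox (tau : R) : set (Cx R) :=
  [set z | `|complex.Re z| <= 1 + tau /\ `|complex.Im z| <= tau].

Lemma compact_cbox tau : compact (cbox tau).
Proof.
have -> : cbox tau = (fun p : R * R => Complex p.1 p.2 : Cx R) @`
    (`[- (1 + tau), 1 + tau] `*` `[- tau, tau]).
  apply/seteqP; split => z /=.
    case: z => a b [/= ha hb]; exists (a, b) => //=.
    by rewrite !in_itv /= -!ler_norml.
  by case=> -[a b] /=; rewrite !in_itv /= -!ler_norml => -[ha hb] <-.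
apply: continuous_compact; last by apply: compact_setX; apply: segment_compact.
apply: continuous_subspaceT => -[a b].
apply/(@cvgrPdist_lt _ (Cx R)^o) => e e0.
have eE : e = ((complex.Re e)%:C)%C.
  by move: e0; rewrite ltcE /= => /andP[/eqP]; case: (e) => x y /= ->.
have e1 : 0 < complex.Re e / 2 by move: e0; rewrite eE ltcR => ?; rewrite divr_gt0.
exists (ball a (complex.Re e / 2), ball b (complex.Re e / 2)) => /=.
  by split; exact: nbhsx_ballx.
move=> [a' b'] /= [ha hb]; rewrite /ball /= in ha hb.
rewrite eE norm_complexE ltcR; apply: le_lt_trans (normc_le_ReIm _) _ => /=.
lra.
Qed.

(** Continuity gives a local bound near each point, and compactness of the product of boxes makes
    one bound work everywhere. *)
Lemma box_bounded N tau (F : 'rV[Cx R]_N -> (Cx R)^o) :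
  (forall z : 'rV[Cx R]_N, (forall k, cbox tau (z 0 k)) -> differentiable F z) ->
  exists2 M : R, 0 < M & forall z : 'rV[Cx R]_N, (forall k, cbox tau (z 0 k)) -> normc (F z) <= M.
Proof.
move=> Fd.
have cK := @rV_compact (Cx R) N (fun=> cbox tau) (fun=> @compact_cbox tau).
have := (compact_near_coveringP _).1 cK R (nbhs +oo)
  (fun M z => normc (F z) <= M) _.
case=> [z zK|M0 [_ H]].
  have /cvgrPdist_lt /(_ (1 : Cx R) ltr01) Fz := differentiable_continuous (Fd z zK).
  exists ([set z' | `|F z - F z'| < 1], [set M | normc (F z) + 1 < M]) => /=.
    by split => //; apply: nbhs_pinfty_gt; rewrite num_real.
  move=> [z' M] /= [h1 h2]; apply: ltW; apply: le_lt_trans h2.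
  have -> : F z' = F z - (F z - F z') by rewrite opprB addrC subrK.
  apply: le_trans (normcB _ _) _; rewrite lerD2l.
  by move: h1; rewrite norm_complexE -[1]/((1 : R)%:C)%C ltcR => /ltW.
exists (Num.max 1 (M0 + 1)); first by rewrite lt_max ltr01.
move=> z zK; apply: H => //; rewrite lt_max; apply/orP; right; lra.
Qed.

Definition joukowski (u : C) : C := (u + u^-1) / 2.

Lemma cexpV s t : (cexp s t)^-1 = cexp (- s) (- t) :> C.
Proof.
have h := cexp_neq0 s t.
by apply: (mulfI h); rewrite divff // -cexpD !subrr cexp0.
Qed.

Lemma joukowskiE (s t : R) : joukowski (cexp s t) =
  Complex ((expR s + expR (- s)) / 2 * cos t) ((expR s - expR (- s)) / 2 * sin t).
Proof.
have h2 : (2 : C)^-1 = ((2^-1 : R)%:C)%C by rewrite fmorphV rmorph_nat.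
rewrite /joukowski cexpV h2 /cexp cosN sinN; apply/eqP; rewrite eq_complex /=.
by apply/andP; split; apply/eqP; ring.
Qed.

Lemma joukowski_box (s t tau : R) : 0 < tau -> `|s| <= ln (1 + tau) ->
  cbox tau (joukowski (cexp s t)).
Proof.
move=> tau0 sr; rewrite joukowskiE /cbox /=.
have E : expR (ln (1 + tau)) = 1 + tau by rewrite lnK // posrE; lra.
have b x : `|x| <= ln (1 + tau) -> expR x <= 1 + tau.
  by move=> /(le_trans (ler_norm _)); rewrite -[in X in _ -> X]E ler_expR.
have e1 := b _ sr; have := b (- s); rewrite normrN => /(_ sr) e2.
have p1 := expR_gt0 s; have p2 := expR_gt0 (- s).
have pq : expR s * expR (- s) = 1 by rewrite -expRD subrr expR0.
(* Each exponential is at least 1/(1 + tau) >= 1 - tau, so half their difference stays within tau,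
   while half their sum is at most 1 + tau. *)
have l1 : 1 - tau <= expR s by nra.
have l2 : 1 - tau <= expR (- s) by nra.
split; rewrite normrM -[leRHS]mulr1; apply: ler_pM => //; rewrite ?cos_max ?sin_max //.
  by rewrite ler_norml; lra.
by rewrite ler_norml; lra.
Qed.

Lemma cdiff_joukowski u : u != 0 -> cdiff joukowski u.
Proof.
move=> u0; apply: cdiffM; last exact: cdiff_cst.
have -> : (fun x : C => x + x^-1) = (fun x => x - (- 1) * x^-1).
  by apply/funext => x; rewrite mulN1r opprK.
apply: cdiffB; first exact: cdiff_id.
apply: cdiffM; first exact: cdiff_cst.
by apply: (@cdiffV _ id) => //; apply: cdiff_id.
Qed.

Lemma slice_cdiff N (F : 'rV[Cx R]_N -> (Cx R)^o) (v0 : 'rV[Cx R]_N) (i : 'I_N) u :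
  u != 0 -> differentiable F (v0 + (joukowski u : Cx R) *: delta_mx 0 i) ->
  cdiff (fun u => F (v0 + (joukowski u : Cx R) *: delta_mx 0 i)) u.
Proof.
move=> u0 Fd.
pose J : (Cx R)^o -> (Cx R)^o := joukowski; pose u' : (Cx R)^o := u.
pose G : (Cx R)^o -> 'rV[Cx R]_N := fun u => v0 + J u *: delta_mx 0 i.
have Jd : differentiable J u' by apply: cdiff_differentiable; apply: cdiff_joukowski.
have Gd1 : differentiable (fun u : (Cx R)^o => J u *: (delta_mx 0 i : 'rV[Cx R]_N)) u'.
  exact: differentiableZl.
have Gd : differentiable G u'.
  exact: differentiableD (differentiable_cst _ _) Gd1.
apply: (@differentiable_cdiff _ (F \o G)).
exact: (differentiable_comp Gd Fd).
Qed.

Lemma slice_approx N tau (F : 'rV[Cx R]_N -> (Cx R)^o) (phi : 'rV[R]_N -> R) Mb s :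
  0 < tau -> 0 < s < ln (1 + tau) ->
  (forall z : 'rV[Cx R]_N, (forall k, cbox tau (z 0 k)) -> differentiable F z) ->
  (forall z : 'rV[Cx R]_N, (forall k, cbox tau (z 0 k)) -> normc (F z) <= Mb) ->
  (forall v, in_cube v -> F (map_mx (fun r : R => (r%:C)%C : Cx R) v) = ((phi v)%:C)%C) ->
  forall K i v, in_cube v ->
  `|phi v - \sum_(j < K.*2.+1) cheb_kernel K j (v 0 i) * phi (upd v i (cheb_node R K j))|
    <= (1 + K.*2.+1%:R) * (quot_const s * Mb * expR (- s) ^+ K).
Proof.
move=> tau0 /andP[s0 sr] Fd FM Fphi K i v vc.
have r0 : 0 < ln (1 + tau) by apply: lt_trans sr.
pose v0 : 'rV[Cx R]_N := \row_k (if k == i then 0 else ((v 0 k)%:C)%C).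
pose B u := F (v0 + (joukowski u : Cx R) *: delta_mx 0 i) : C.
have rowE z k : (v0 + (z : Cx R) *: delta_mx 0 i) 0 k = if k == i then z else ((v 0 k)%:C)%C.
  by rewrite !mxE eqxx /=; case: eqP => _; rewrite ?mulr1 ?add0r ?mulr0 ?addr0.
have inbox z : cbox tau z -> forall k, cbox tau ((v0 + z *: delta_mx 0 i) 0 k).
  move=> zb k; rewrite rowE; case: eqP => // _; split; rewrite /= ?normr0; last by rewrite ltW.
  by have := vc k; rewrite -ler_norml; lra.
have Bd s' t : `|s'| <= ln (1 + tau) -> cdiff B (cexp s' t).
  move=> hs; apply: slice_cdiff; first exact: cexp_neq0.
  by apply: Fd; apply: inbox; apply: joukowski_box.
have BM s' t : `|s'| <= ln (1 + tau) -> normc (B (cexp s' t)) <= Mb.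
  by move=> hs; apply: FM; apply: inbox; apply: joukowski_box.
have ss : 0 < s < ln (1 + tau) by rewrite s0.
have [c Hc] := fourier_approx r0 Bd BM K ss.
have := @cheb_kernel_approx R K (fun y => phi (upd v i y)) c (quot_const s * Mb * expR (- s) ^+ K).
have updid : upd v i (v 0 i) = v by apply/rowP => k; rewrite mxE; case: eqP => [->|].
have BE t : B (cexp 0 t) = ((phi (upd v i (cos t)))%:C)%C.
  rewrite -Fphi; last by apply: upd_cube => //; rewrite cos_geN1 cos_le1.
  rewrite /B; congr F; apply/rowP => k; rewrite rowE !mxE joukowskiE oppr0 expR0.
  case: eqP => // _; rewrite subrr mul0r mul0r.
  by have -> : (1 + 1) / 2 * cos t = cos t :> R by field.
by move=> /(_ _ (v 0 i) (vc i)); rewrite updid; apply => t; rewrite -BE.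
Qed.

End Box.

(** * Choice of the degree *)

Section Rate.
Variable R : realType.

(** Each square has real part at least minus its squared imaginary part, and N (t/N)^2 = t^2/N <=
    t^2. *)
Lemma cbox_reg_set N (t : R) (z : 'rV[Cx R]_N) : (0 < N)%N -> 0 < t ->
  (forall k, cbox (t / N%:R) (z 0 k)) -> reg_set t z.
Proof.
move=> N0 t0 zb; rewrite /reg_set /= raddf_sum /=.
have N1 : 1 <= N%:R :> R by rewrite ler1n.
apply: (@le_trans _ _ (\sum_(i < N) - (t / N%:R) ^+ 2)).
  rewrite sumr_const card_ord mulNrn lerN2 -[leLHS]mulr_natr.
  have -> : (t / N%:R) ^+ 2 * N%:R = t ^+ 2 / N%:R by field; rewrite gt_eqF //; lra.
  by rewrite ler_pdivrMr; [rewrite ler_peMr // sqr_ge0 | lra].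
apply: ler_sum => i _; have [_] := zb i; case: (z 0 i) => a b /=.
move=> hb; rewrite -[leRHS]/(complex.Re ((a +i* b)%C ^+ 2)).
have -> : complex.Re ((a +i* b)%C ^+ 2) = a ^+ 2 - b ^+ 2 by rewrite expr2 /=; ring.
have : b ^+ 2 <= (t / N%:R) ^+ 2.
  rewrite -[b ^+ 2]real_normK ?num_real // ler_pXn2r ?nnegrE //.
  by rewrite divr_ge0 // ltW.
by have := sqr_ge0 a; lra.
Qed.

Lemma poly_exp_bound (s : R) p : 0 < s -> exists2 C, 0 < C &
  forall K, K.*2.+1%:R ^+ p * expR (- s) ^+ K <= C * expR (- (s / 2)) ^+ K.
Proof.
move=> s0; have p1 : 0 < p.+1%:R :> R by rewrite ltr0n.
(* Each factor 2K+1 is paid for by exp(aK), and p + 1 of them use up exactly half of the decay s.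
   Taking p + 1 instead of p avoids dividing by zero. *)
pose a := s / (2 * p.+1%:R).
have a0 : 0 < a by rewrite divr_gt0 // mulr_gt0.
exists ((2 / a + 1) ^+ p.+1); first by rewrite exprn_gt0 // addr_gt0 // divr_gt0.
move=> K; have b : K.*2.+1%:R <= (2 / a + 1) * expR (a * K%:R).
  have h := expR_ge1Dx (a * K%:R); have K0 : 0 <= a * K%:R by rewrite mulr_ge0 // ltW.
  rewrite mulrDl mul1r -natr1 -muln2 natrM; apply: lerD; last by lra.
  have -> : K%:R * 2 = 2 / a * (a * K%:R) by field; rewrite gt_eqF.
  by rewrite ler_wpM2l ?divr_ge0 ?(ltW a0) //; lra.
have E : expR (a * K%:R) ^+ p.+1 * expR (- s) ^+ K = expR (- (s / 2)) ^+ K.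
  rewrite -!expRM_natl -expRD; congr expR; rewrite /a; field.
  by rewrite addrC natr1 gt_eqF.
apply: (@le_trans _ _ (K.*2.+1%:R ^+ p.+1 * expR (- s) ^+ K)).
  rewrite ler_wpM2r ?exprn_ge0 ?expR_ge0 // exprS ler_peMl ?exprn_ge0 //.
  by rewrite ler1n.
rewrite -E mulrA -exprMn ler_wpM2r ?exprn_ge0 ?expR_ge0 //.
by rewrite ler_pXn2r ?nnegrE // (le_trans _ b).
Qed.

Lemma choose_degree (A q : R) m : 0 < A -> 0 < q ->
  exists C eps0 : R, 0 < eps0 /\ forall eps, 0 < eps -> exists K,
    A * expR (- q) ^+ K <= eps /\
    (eps < eps0 -> (K.+1 ^ m)%N%:R <= C * ln eps^-1 ^+ m).
Proof.
(* Below exp(-1), ln(1/eps) is at least 1 and absorbs additive constants; below 1/A, ln(A/eps) is at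
   most 2 ln(1/eps). Hence K + 1 <= x + 2 <= (2/q + 2) ln(1/eps). *)
move=> A0 q0; exists ((2 / q + 2) ^+ m), (Num.min (expR (- 1)) A^-1).
split; first by rewrite lt_min expR_gt0 invr_gt0.
(* The real solution of A exp(-qx) = eps, cut off at 0 for eps larger than A, where the logarithm is
   negative. *)
move=> eps e0; pose x := Num.max 0 (ln (A / eps) / q).
have x0 : 0 <= x by rewrite le_max lexx.
have Ae : 0 < A / eps by rewrite divr_gt0.
exists (Num.truncn x).+1; split.
  have h : ln (A / eps) <= q * (Num.truncn x).+1%:R.
    rewrite [leRHS]mulrC -ler_pdivrMr //; apply: le_trans (ltW (truncnS_gt x)).
    by rewrite le_max lexx orbT.
  rewrite -expRM_natl mulrN expRN ler_pdivrMr ?expR_gt0 // [leRHS]mulrC -ler_pdivrMr //.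
  by rewrite -[leLHS]lnK ?posrE // ler_expR [leRHS]mulrC.
rewrite lt_min => /andP[e1 e2].
have l1 : 1 <= ln eps^-1.
  rewrite -(expRK 1) ler_ln ?posrE ?expR_gt0 ?invr_gt0 //.
  by rewrite -[leLHS]invrK lef_pV2 ?posrE ?invr_gt0 ?expR_gt0 // -expRN ltW.
have l2 : ln (A / eps) <= 2 * ln eps^-1.
  rewrite lnM ?posrE ?invr_gt0 // mulr_natl mulr2n lerD2r ler_ln ?posrE ?invr_gt0 //.
  by rewrite -[A]invrK lef_pV2 ?posrE ?invr_gt0 // ltW.
rewrite natrX -exprMn; apply: lerXn2r; rewrite ?nnegrE ?mulr_ge0 //.
- by rewrite addr_ge0 // divr_ge0 // ltW.
- by apply: le_trans l1.
have x1 : x <= 2 / q * ln eps^-1.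
  have q2 : 0 <= 2 / q by rewrite divr_ge0 // ltW.
  rewrite ge_max mulr_ge0 //=; last by apply: le_trans l1.
  by rewrite ler_pdivrMr // mulrAC divfK ?gt_eqF.
have := truncn_le x; rewrite x0 => xt; rewrite -natr1 -natr1 mulrDl; lra.
Qed.

End Rate.

Theorem theorem2 (R : realType) (n m : nat) (f : 'rV[R]_n -> 'rV[R]_m -> R)
    (t : R) :
  (0 < n)%N -> (0 < m)%N -> 0 < t ->
  analytic_ext_on f ((@reg_set R (n + m)%N t)) ->
  exists (C eps0 : R), 0 < eps0 /\
    forall eps : R, 0 < eps ->
      exists (h : nat) (phi : 'rV[R]_n -> 'rV[R]_h) (a : 'rV[R]_m -> 'cV[R]_h),
        [/\ (0 < h)%N, cheb_row phi, cheb_col a,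
            (forall x w, in_cube x -> in_cube w ->
               `|f x w - (phi x *m a w) 0 0| <= eps) &
            (eps < eps0 -> h%:R <= C * (ln (eps^-1)) ^+ m)].
Proof.
move=> n0 m0 t0 [U [F [_ SU Fd Ff]]].
have N0 : (0 < n + m)%N by rewrite addn_gt0 n0.
set tau : R := t / (n + m)%:R.
have tau0 : 0 < tau by rewrite divr_gt0 // ltr0n.
have Fbox (z : 'rV[Cx R]_(n + m)) : (forall k, cbox tau (z 0 k)) -> differentiable F z.
  by move=> /(cbox_reg_set N0 t0)/SU/Fd.
have [Mb Mb0 FM] := box_bounded Fbox.
pose s := ln (1 + tau) / 2.
have r0 : 0 < ln (1 + tau) by rewrite ln_gt0 // ltrDl.
have s0 : 0 < s by rewrite divr_gt0.
have sr : 0 < s < ln (1 + tau) by rewrite s0 /s; lra.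
pose phi (v : 'rV[R]_(n + m)) := f (lsubmx v) (rsubmx v).
have cubel x w : in_cube (row_mx x w : 'rV[R]_(n + m)) <-> in_cube x /\ in_cube w.
  split=> [h|[hx hw] k]; last by rewrite mxE; case: fintype.splitP => j _.
  by split=> k; [have := h (lshift m k); rewrite row_mxEl|have := h (rshift n k); rewrite row_mxEr].
have Fphi v : in_cube v -> F (map_mx (fun r : R => (r%:C)%C : Cx R) v) = ((phi v)%:C)%C.
  move=> vc; have [xc wc] := (cubel (lsubmx v) (rsubmx v)).1 (eq_ind_r _ vc (hsubmxK v)).
  by rewrite -Ff // hsubmxK.
have approx := slice_approx tau0 sr Fbox FM Fphi.
pose A := quot_const s * Mb.
have A0 : 0 < A.
  rewrite !mulr_gt0 // addr_gt0 // invr_gt0 subr_gt0; last by rewrite -expR0 ltr_expR.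
  by rewrite -expR0 ltr_expR oppr_lt0.
(* One power of 2K+1 for each interpolated coordinate, and one more from the factor 1 + (2K+1) in
   the one-variable error. That factor is at most 2(2K+1), whence the 2 in the constant passed to
   [choose_degree]. *)
have [C1 C10 HC1] := poly_exp_bound (n + m).+1 s0.
have [||C [eps0 [eps00 H]]] := @choose_degree R (2 * (n + m)%:R * A * C1) (s / 2) m _ _.
- by apply: mulr_gt0 => //; apply: mulr_gt0 => //; apply: mulr_gt0 => //; rewrite ltr0n.
- by rewrite divr_gt0.
exists C, eps0; split => // eps e0; have [K [K1 K2]] := H eps e0.
pose eta := (1 + K.*2.+1%:R) * (A * expR (- s) ^+ K).
have eta0 : 0 <= eta by rewrite mulr_ge0 // mulr_ge0 ?exprn_ge0 ?expR_ge0 // ltW.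
have [||ph [a [h1 h2 h3]]] := @separated_approx R K n m f eta eta0 _ _.
- move=> i x w xc wc; have := approx K (lshift m i) (row_mx x w) ((cubel x w).2 (conj xc wc)).
  rewrite /phi row_mxKl row_mxKr row_mxEl; congr (`| _ - _ | <= _).
  apply: eq_bigr => j _; congr (_ * f _ _); apply/rowP => k; rewrite [LHS]mxE [LHS]mxE ?[RHS]mxE.
    by rewrite (inj_eq (@lshift_inj _ _)) row_mxEl.
  by rewrite eq_rlshift row_mxEr.
- move=> i x w xc wc; have := approx K (rshift n i) (row_mx x w) ((cubel x w).2 (conj xc wc)).
  rewrite /phi row_mxKl row_mxKr row_mxEr; congr (`| _ - _ | <= _).
  apply: eq_bigr => j _; congr (_ * f _ _); apply/rowP => k; rewrite [LHS]mxE [LHS]mxE ?[RHS]mxE.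
    by rewrite eq_lrshift row_mxEl.
  by rewrite (inj_eq (@rshift_inj _ _)) row_mxEr.
exists (K.+1 ^ m)%N, ph, a; split => //; first by rewrite expn_gt0.
move=> x w xc wc; apply: le_trans (h3 x w xc wc) _; apply: le_trans K1.
have := HC1 K; rewrite exprS /eta; set L : R := K.*2.+1%:R => HL.
have L0 : 1 <= L by rewrite ler1n.
have L1 : 1 + L <= 2 * L by lra.
apply: (@le_trans _ _ ((n + m)%:R * L ^+ (n + m) * (2 * L * (A * expR (- s) ^+ K)))).
  rewrite ler_wpM2l ?mulr_ge0 ?exprn_ge0 // ler_wpM2r //.
  by rewrite mulr_ge0 ?exprn_ge0 ?expR_ge0 // ltW.
have -> : (n + m)%:R * L ^+ (n + m) * (2 * L * (A * expR (- s) ^+ K)) =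
  2 * (n + m)%:R * A * (L * L ^+ (n + m) * expR (- s) ^+ K) by ring.
rewrite -[leRHS]mulrA; apply: ler_wpM2l => //; apply: mulr_ge0; last exact: ltW.
exact: mulr_ge0.
Qed.
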